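(* Let $K\subset\mathbb{R}^2$ be a convex body that has a center of symmetry and contains the origin, and let $1<p<\infty$. Then $$|K\oplus_p-K|\le\left(\frac{2\,\Gamma\left(1+\frac1q\right)^2}{\Gamma\left(1+\frac2q\right)}+2\right)|K| ,$$ where $q$ satisfies $\frac1p+\frac1q=1$. Equality holds if $K$ is a parallelogram with a vertex at the origin.
   Context: A convex body is a compact convex set with nonempty interior. $K$ has a center of symmetry if there is $a\in K$ with $K-a=a-K$. $|\cdot|$ is Lebesgue measure on $\mathbb{R}^2$; $h_K(x)=\sup_{k\in K}\langle x,k\rangle$. For compact convex sets $K,L$ containing the origin, $K\oplus_pL$ is the compact convex set with $h_{K\oplus_pL}=(h_K^p+h_L^p)^{1/p}$; $-K=\{-k:k\in K\}$ and $K\oplus_p-K$ means $K\oplus_p(-K)$. *)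

(* Defs.v *)
From mathcomp Require Import all_boot all_order all_algebra.
From mathcomp Require Import all_classical all_reals all_analysis.
Import numFieldNormedType.Exports.

Set Implicit Arguments.
Unset Strict Implicit.
Unset Printing Implicit Defensive.

Import Order.TTheory GRing.Theory Num.Theory.

Local Open Scope classical_set_scope.
Local Open Scope ring_scope.

(** MathComp-Analysis.  The components are [R^o] rather than [R] so that the
    pair type carries a module structure over [R]. *)
Notation plane R := (R^o * R^o)%type.

(** Lebesgue measure lives on the measurable type [R * R], convertible to
    [plane R]. *)
Definition area (R : realType) (A : set (plane R)) : \bar R :=
  (@lebesgue_measure R \x @lebesgue_measure R)%E (A : set (R * R)).

Definition inner_prod (R : realType) (x y : plane R) : R :=
  x.1 * y.1 + x.2 * y.2.

Definition convex_body (R : realType) (K : set (plane R)) : Prop :=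
  [/\ compact K, convex_set K & K° !=set0].

Definition has_center_of_symmetry (R : realType) (K : set (plane R)) : Prop :=
  exists2 a, K a & [set k - a | k in K] = [set a - k | k in K].

Definition opp_set (R : realType) (K : set (plane R)) : set (plane R) :=
  [set - k | k in K].

Definition support_fun (R : realType) (K : set (plane R)) (x : plane R) : R :=
  sup [set inner_prod x k | k in K].

(** Nonemptiness is required because [support_fun set0] is the junk value
    [0], which is also the support function of [[set 0]]. *)
Definition is_Lp_sum (R : realType) (p : R) (K L M : set (plane R)) : Prop :=
  [/\ M !=set0, compact M, convex_set M &
      forall x, support_fun M x =
        (support_fun K x `^ p + support_fun L x `^ p) `^ p^-1].

(** For [1 <= p] and compact convex [K], [L] containing the origin, exactly
    one set satisfies [is_Lp_sum p K L], because the prescribed function is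
    then sublinear. *)
Definition Lp_sum (R : realType) (p : R) (K L : set (plane R)) :
  set (plane R) := get (is_Lp_sum p K L).

(** Meant for [0 < s], where the integral converges. *)
Definition Gamma (R : realType) (s : R) : R :=
  \int[@lebesgue_measure R]_(t in `]0, +oo[) (t `^ (s - 1) * expR (- t)).

(** [a] is one of the vertices of [K], and [u], [v] are the edges at [a]. *)
Definition parallelogram_with_vertex (R : realType) (a : plane R)
    (K : set (plane R)) : Prop :=
  exists u v : plane R, free [:: u; v] /\
    K = [set x | exists s t : R, [/\ 0 <= s <= 1, 0 <= t <= 1 &
                                     x = a + s *: u + t *: v]].

(* Main.v *)
Require Import Defs.
From HB Require Import structures.
From mathcomp Require Import all_boot all_order all_algebra.
From mathcomp Require Import all_classical all_reals all_analysis.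
From mathcomp Require Import unstable measurable_realfun ring lra.
Import numFieldNormedType.Exports.
Import Order.TTheory GRing.Theory Num.Theory.
Local Open Scope classical_set_scope.
Local Open Scope ring_scope.

Set Implicit Arguments.
Unset Strict Implicit.
Unset Printing Implicit Defensive.

(** Write [Q] for the part of the l_q unit ball in the first quadrant.  By
    Hoelder's inequality, with its equality case, the convex body with support
    function (h_K^p + h_L^p)^(1/p) is {s k + t l : (s, t) in Q, k in K, l in L},
    because a compact convex set is determined by its support function
    ([Lp_sumE]).  For L = -K this is the set {s k - t l} of differences,
    [lp_diff q K].  The constant of the theorem is c = 2 + 2 |Q| ([lq_cstE]):
    integrating exp(-(s^q + t^q)) over the first quadrant, once as a product
    and once by its level sets, gives
    |Q| Gamma(1 + 2/q) = Gamma(1 + 1/q)^2.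

    Two facts about K |-> {s k - t l} drive the proof.  It commutes with linear
    maps, so the ratio |{s k - t l}| / |K| is a linear invariant.  And if
    bodies are added along vertical lines only ([fiber_add]), then the
    difference set of the sum lies in the vertical sum of the difference sets
    ([lp_diff_fiber_add]), while by Fubini the area of a vertical sum is at most
    the sum of the areas, with equality when both bodies have the same shadow
    on the horizontal axis ([area_fiber_add]).  Hence the bodies which contain
    the origin, have a given shadow and satisfy the inequality with constant c
    are stable under vertical addition ([lp_good_fiber_add]).

    For the unit square with a vertex at the origin, {s k - t l} is the union
    of the squares [-t, s]^2, that is two unit squares and two reflected copies
    of Q: its area is exactly c, and this gives the equality case.  A box
    containing the origin is cut by the axes into four boxes with a vertex at
    the origin, and it is recovered from them by vertical and horizontal
    addition, so all parallelograms that contain the origin satisfy the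
    inequality ([area_lp_diff_parallelogram]).

    It remains to write a centrally symmetric body as a vertical sum of
    parallelograms.  A linear map puts its centre on the vertical axis and
    makes its shadow [-1, 1]; the body is then
    {(x, y) : -1 <= x <= 1, a - g(-x) <= y <= a + g(x)} with g concave, and it
    contains the origin when a = th * g(0) with |th| <= 1.  When g is
    piecewise linear, it is an affine function plus a nonnegative combination
    of tents ([hinge_tent], [lp_goodf_interp]); each summand gives a
    parallelogram, and giving each of them the centre of height th times its
    own value at 0 keeps the origin in all of them.  The general case follows by
    approximating a slight dilate of the body from inside by interpolation: the
    dilation makes the boundary function Lipschitz on [-1, 1], and a small
    constant added to the interpolant covers the body
    ([lp_diff_bound_dilate]). *)

(** * Area: measurability and linear maps *)

(** The same carrier as [plane R], with the product sigma-algebra. *)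
Notation mplane R := (measurableTypeR R * measurableTypeR R)%type.

Lemma dist_lt_split (R : realType) (r x y d e : R) :
  `|r - x| < d -> `|r - y| < d -> d < e / 2 -> `|x - y| < e.
Proof.
move=> rx ry de; rewrite (le_lt_trans (ler_distD r _ _))// (distrC x); lra.
Qed.

(** The product topology has a countable base of rational boxes, so the open
    sets belong to the product sigma-algebra. *)
Lemma open_plane_measurable (R : realType) (U : set (plane R)) :
  open U -> measurable (U : set (mplane R)).
Proof.
move=> oU.
pose box (n : rat * rat * nat) : set (mplane R) :=
  ball (ratr n.1.1 : R^o) n.2.+1%:R^-1 `*` ball (ratr n.1.2 : R^o) n.2.+1%:R^-1.
pose G n : set (mplane R) := if `[< box n `<=` U >] then box n else set0.
have -> : U = \bigcup_n G n.
  apply/seteqP; split => [[x y] Uxy|z [n _]]; last first.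
    by rewrite /G; case: ifPn => // /asboolP; apply.
  have /nbhs_ballP[e /= e0 eU] : nbhs ((x, y) : plane R) U by exact: open_nbhs_nbhs.
  have [n /= ne] : exists n, n.+1%:R^-1 < e / 2.
    near \oo => n; exists n.
    by near: n; apply: near_infty_natSinv_lt (PosNum _); rewrite divr_gt0.
  have rat_ball (t : R) : exists r : rat, `|ratr r - t| < n.+1%:R^-1.
    have n0 : 0 < n.+1%:R^-1 :> R by rewrite invr_gt0.
    have /rat_in_itvoo[r] : t - n.+1%:R^-1 < t + n.+1%:R^-1.
      by rewrite ltrD2l gtrN.
    by rewrite in_itv/= => rt; exists r; rewrite ltr_distl.
  have [[r rx] [s sy]] := (rat_ball x, rat_ball y).
  have Bxy : box (r, s, n) (x, y) by split; rewrite /ball/= .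
  have BU : box (r, s, n) `<=` U.
    move=> [x' y'] [/= rx' sy']; apply: eU; split => /=; rewrite /ball/= in rx' sy' *.
      exact: dist_lt_split rx rx' ne.
    exact: dist_lt_split sy sy' ne.
  by exists (r, s, n) => //; rewrite /G; case: ifPn => // /asboolP.
apply: countable_bigcupT_measurable; first exact: countableP.
move=> n; rewrite /G; case: ifPn => // _.
by apply: measurableX; apply: open_measurable; exact: ball_open.
Unshelve. all: end_near. Qed.

Lemma compact_plane_measurable (R : realType) (U : set (plane R)) :
  compact U -> measurable (U : set (mplane R)).
Proof.
move=> cU.
have : closed U by apply: compact_closed => //; exact: norm_hausdorff.
rewrite -openC => /open_plane_measurable /measurableC.
by rewrite setCK.
Qed.

Section affine_line.
Variable R : realType.
Local Notation mu := (@lebesgue_measure R).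
Local Open Scope ereal_scope.

(** The push-forward of Lebesgue measure, scaled by |a|, agrees with Lebesgue
    measure on half-open intervals, hence everywhere by uniqueness. *)
Lemma lebesgue_measure_affine (a b : R) (B : set (measurableTypeR R)) :
  (a != 0)%R -> measurable B ->
  mu ((fun y => a * y + b)%R @^-1` B) = (`|a|^-1)%:E * mu B.
Proof.
move=> a0 mB.
pose f : measurableTypeR R -> measurableTypeR R := fun y => (a * y + b)%R.
have mf : measurable_fun setT f.
  by apply: measurable_funD => //; exact: measurable_funM.
have H : mu B = (`|a|)%:E * mu (f @^-1` B).
  apply: (@lebesgue_measure_unique R
    (mscale (NngNum (normr_ge0 a)) (pushforward mu f)) _ B mB).
  move=> _ [[u v]] _ <-.
  change (mu `]u, v] = (`|a|)%:E * mu (f @^-1` `]u, v])).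
  have [a_gt0|a_lt0|a_eq] := ltgtP a 0%R; last by rewrite a_eq eqxx in a0.
  - rewrite (_ : f @^-1` _ = `[(v - b) / a, (u - b) / a[%classic)%R.
      rewrite !lebesgue_measure_itv/= !lte_fin.
      rewrite ltr_ndivrMr// mulrVK ?unitfE// ltrD2r.
      case: ifPn => uv; last by rewrite mule0.
      by rewrite -EFinM ltr0_norm//; congr EFin; field.
    apply/seteqP; split => y /=; rewrite !in_itv/= /f => /andP[].
      by rewrite ler_ndivrMr// ltr_ndivlMr// => *; lra.
    by rewrite ler_ndivrMr// ltr_ndivlMr// => *; lra.
  - rewrite (_ : f @^-1` _ = `](u - b) / a, (v - b) / a]%classic)%R.
      rewrite !lebesgue_measure_itv/= !lte_fin.
      rewrite ltr_pdivlMr// mulrVK ?unitfE// ltrD2r.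
      case: ifPn => uv; last by rewrite mule0.
      by rewrite -EFinM gtr0_norm//; congr EFin; field.
    apply/seteqP; split => y /=; rewrite !in_itv/= /f => /andP[].
      by rewrite ler_pdivlMr// ltr_pdivrMr// => *; lra.
    by rewrite ler_pdivlMr// ltr_pdivrMr// => *; lra.
by rewrite H muleA -EFinM mulVf ?normr_eq0// mul1e.
Qed.

End affine_line.

Section area_basics.
Variable R : realType.
Local Notation mu := (@lebesgue_measure R).
Local Open Scope ereal_scope.
Implicit Types S : set (mplane R).

Lemma area_ge0 S : 0 <= area S.
Proof. exact: measure_ge0. Qed.

Lemma le_area S1 S2 : measurable S1 -> measurable S2 -> S1 `<=` S2 ->
  area S1 <= area S2.
Proof. by move=> m1 m2 S12; rewrite /area le_measure ?inE. Qed.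

Lemma area_setX (A B : set (measurableTypeR R)) : measurable A -> measurable B ->
  area (A `*` B) = mu A * mu B.
Proof. by move=> mA mB; rewrite /area product_measure1E. Qed.

Lemma measurable_preimage_swap S : measurable S ->
  measurable (@swap _ _ @^-1` S : set (mplane R)).
Proof.
move=> mS; have : measurable_fun setT (@swap _ _ : mplane R -> mplane R).
  exact: measurable_swap.
by move=> /(_ measurableT _ mS); rewrite setTI.
Qed.

Lemma area_swap S : measurable S -> area (@swap _ _ @^-1` S) = area S.
Proof.
move=> mS; have ms : measurable_fun setT (@swap _ _ : mplane R -> mplane R).
  exact: measurable_swap.
apply/esym; apply: (@product_measure_unique _ _ _ _ _ mu mu
  (pushforward (mu \x mu) (@swap _ _ : mplane R -> mplane R)) _ S mS).
move=> A B mA mB; change ((mu \x mu) (@swap _ _ @^-1` (A `*` B)) = mu A * mu B).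
rewrite (_ : _ @^-1` _ = B `*` A) ?product_measure1E 1?muleC//.
by apply/seteqP; split => -[x y] [].
Qed.

Definition linmap (a b c d : R) (v : plane R) : plane R :=
  (a * v.1 + b * v.2, c * v.1 + d * v.2)%R.

Lemma measurable_linmap (a b c d : R) S : measurable S ->
  measurable (linmap a b c d @^-1` S : set (mplane R)).
Proof.
move=> mS; have : measurable_fun setT (linmap a b c d : mplane R -> mplane R).
  by apply/measurable_fun_pairP; split; apply: measurable_funD;
    apply: measurable_funM.
by move=> /(_ measurableT _ mS); rewrite setTI.
Qed.

(** A map that preserves each vertical line acts on each section by an affine
    map, so Fubini reduces the claim to the line. *)
Lemma area_vert (a k : R) S : (a != 0)%R -> measurable S ->
  area (linmap 1 0 k a @^-1` S) = (`|a|^-1)%:E * area S.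
Proof.
move=> a0 mS; rewrite /area /product_measure1 -ge0_integralZl//; last first.
  exact: measurable_fun_xsection.
apply: eq_integral => x _ /=.
rewrite -(@lebesgue_measure_affine _ a (k * x)%R)//; last exact: measurable_xsection.
congr (mu _); apply/seteqP; split => y; rewrite /xsection/= !inE/= /linmap/=;
  by rewrite mul1r mul0r addr0 (addrC (k * x)%R).
Qed.

(** When [a != 0] the matrix is a product of two maps that preserve vertical
    lines and two exchanges of coordinates; one more exchange reduces [a = 0]
    to this case. *)
Lemma area_linmap (a b c d : R) S : (a * d - b * c != 0)%R -> measurable S ->
  area (linmap a b c d @^-1` S) = (`|a * d - b * c|^-1)%:E * area S.
Proof.
have H (a' b' c' d' : R) S' : (a' != 0)%R -> (a' * d' - b' * c' != 0)%R -> measurable S' ->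
  area (linmap a' b' c' d' @^-1` S') = (`|a' * d' - b' * c'|^-1)%:E * area S'.
  move=> a0 D0 mS'.
  have -> : linmap a' b' c' d' = linmap 1 0 (c' / a') ((a' * d' - b' * c') / a') \o @swap _ _
      \o linmap 1 0 b' a' \o @swap _ _.
    by apply/funext => -[x y]; rewrite /linmap/= /swap/=; congr pair; field.
  have m1 := measurable_linmap 1 0 (c' / a') ((a' * d' - b' * c') / a') mS'.
  have m2 := measurable_preimage_swap m1.
  rewrite !comp_preimage area_swap; last exact: (measurable_linmap 1 0 b' a' m2).
  rewrite area_vert// area_swap//.
  rewrite area_vert ?mulf_neq0 ?invr_eq0//.
  rewrite muleA -EFinM; congr (_%:E * _).
  by rewrite normrM normfV invfM invrK mulrCA mulVf ?mulr1 ?normr_eq0.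
move=> D0 mS.
have [a0|a0] := eqVneq a 0%R; last exact: H.
have bc : (b * c != 0)%R by move: D0; rewrite a0 mul0r add0r oppr_eq0.
have -> : linmap a b c d = linmap b 0 d c \o @swap _ _.
  by apply/funext => -[x y]; rewrite /linmap/= /swap/= a0; congr pair; ring.
rewrite comp_preimage area_swap; last exact: measurable_linmap.
by rewrite H ?a0 ?mul0r ?subr0 ?add0r ?normrN// (contraNneq _ bc)// => ->; rewrite mul0r.
Qed.

End area_basics.

(** * Fibrewise Minkowski addition *)

Lemma continuous_pair (T U V : topologicalType) (g : T -> U) (h : T -> V) :
  continuous g -> continuous h -> continuous (fun z => (g z, h z)).
Proof. by move=> cg ch z; apply: cvg_pair; [exact: cg|exact: ch]. Qed.

Section convexity.
Variable R : realType.
Implicit Types A B : set (plane R).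

(** Convexity without the bundled unit-interval type of [convex_set]. *)
Definition cvx A := forall x y (t : R), A x -> A y -> 0 <= t <= 1 ->
  A (t *: x + (1 - t) *: y).

Lemma convex_setP A : convex_set A <-> cvx A.
Proof.
split=> cA x y t.
  move=> Ax Ay t01; have := cA x y (Itv01 (proj1 (andP t01)) (proj2 (andP t01))).
  by rewrite !inE => /(_ Ax Ay).
rewrite !inE => Ax Ay.
by apply: cA => //; apply/andP; split.
Qed.

Lemma compact_interval (S : set R) : compact S -> S !=set0 ->
  (forall a b c, S a -> S b -> a <= c <= b -> S c) ->
  exists a b, a <= b /\ S = `[a, b]%classic.
Proof.
move=> cS S0 iS.
have cid : {within S, continuous (@id R)} by apply: continuous_subspaceT => z; exact: cvg_id.
have [b /set_mem Sb bmax] := compact_EVT_max S0 cS cid.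
have [a /set_mem Sa amin] := compact_EVT_min S0 cS cid.
exists a, b; split; first by apply: amin; exact: mem_set.
apply/seteqP; split=> c /=; rewrite in_itv/=; last exact: iS.
by move=> /mem_set Sc; rewrite amin// bmax.
Qed.

End convexity.

Section fiber_add.
Variable R : realType.
Implicit Types A B : set (plane R).
Local Notation mu := (@lebesgue_measure R).

(** Minkowski addition on every vertical line. *)
Definition fiber_add A B : set (plane R) :=
  [set v | exists y1 y2, [/\ A (v.1, y1), B (v.1, y2) & v.2 = y1 + y2]].

Lemma fiber_add_cvx A B : cvx A -> cvx B -> cvx (fiber_add A B).
Proof.
move=> cA cB [x1 x2] [y1 y2] t [/= a [b [Aa Bb ->]]] [/= c [d [Ac Bd ->]]] t01.
exists (t * a + (1 - t) * c), (t * b + (1 - t) * d); split => /=.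
- exact: (cA _ _ t Aa Ac).
- exact: (cB _ _ t Bb Bd).
- by rewrite /GRing.scale/=; ring.
Qed.

Lemma fiber_add_compact A B : compact A -> compact B -> compact (fiber_add A B).
Proof.
move=> cA cB.
pose f (z : plane R * plane R) : plane R := (z.1.1, z.1.2 + z.2.2).
have -> : fiber_add A B = f @` ((A `*` B) `&` [set z | z.1.1 - z.2.1 = 0]).
  apply/seteqP; split => [[x y] /= [a [b [Aa Bb /= ->]]]|].
    by exists ((x, a), (x, b)) => //=; rewrite subrr.
  move=> _ [[[x a] [x' b]] [[/= Aa Bb] /subr0_eq xx'] <-]; exists a, b; split => //.
  by rewrite /f/= xx'.
apply: continuous_compact.
  apply: continuous_subspaceT; apply: continuous_pair.
    by move=> z; apply: (continuous_comp (g := fst)); [exact: cvg_fst|exact: cvg_fst].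
  move=> z; apply: cvgD.
    by apply: (continuous_comp (g := snd)); [exact: cvg_fst|exact: cvg_snd].
  by apply: (continuous_comp (g := snd)); [exact: cvg_snd|exact: cvg_snd].
apply: compact_closedI; first exact: compact_setX.
apply: (@closed_comp _ _ (fun z : plane R * plane R => z.1.1 - z.2.1) [set 0]); last exact: closed_eq.
move=> z _; apply: cvgB.
  by apply: (continuous_comp (g := fst)); [exact: cvg_fst|exact: cvg_fst].
by apply: (continuous_comp (g := fst)); [exact: cvg_snd|exact: cvg_fst].
Qed.

Lemma plane_vert_comb (x a b c : R) : 0 < b - a ->
  (x, c) = ((b - c) / (b - a)) *: (x, a) + (1 - (b - c) / (b - a)) *: (x, b) :> plane R.
Proof.
move=> ab0; have ab : b - a != 0 by exact: lt0r_neq0.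
suff [h1 h2] : x = (b - c) / (b - a) * x + (1 - (b - c) / (b - a)) * x /\
  c = (b - c) / (b - a) * a + (1 - (b - c) / (b - a)) * b.
  by congr pair.
by split; field.
Qed.

Lemma sum_set0l (B : set R) : [set y1 + y2 | y1 in set0 & y2 in B] = set0.
Proof. by apply/seteqP; split => // y [? []]. Qed.

Lemma sum_set0r (A : set R) : [set y1 + y2 | y1 in A & y2 in set0] = set0.
Proof. by apply/seteqP; split => // y [? _ []]. Qed.

Lemma cvx_vertical A (x a b c : R) : cvx A -> A (x, a) -> A (x, b) -> a <= c <= b -> A (x, c).
Proof.
move=> vA Aa Ab /andP[ac cb].
have [e|ab] := eqVneq a b; first by rewrite (_ : c = a)//; apply/eqP; rewrite eq_le ac e cb.
have ab0 : 0 < b - a by rewrite subr_gt0 lt_neqAle ab (le_trans ac).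
rewrite (plane_vert_comb x c ab0); apply: vA => //; apply/andP; split.
  by rewrite divr_ge0 ?subr_ge0// ltW// -subr_gt0.
by rewrite ler_pdivrMr// mul1r lerD2l lerN2.
Qed.

Lemma xsection_cvx A x : compact A -> cvx A -> xsection A x = set0 \/
  exists a b, a <= b /\ xsection A x = `[a, b]%classic.
Proof.
move=> cA vA; have [->|/set0P A0] := eqVneq (xsection A x) set0; [by left|right].
apply: compact_interval => //.
  have -> : xsection A x = snd @` (A `&` [set v | v.1 = x]).
    apply/seteqP; split => y; rewrite /xsection/= inE.
      by move=> Axy; exists (x, y).
    by move=> [[x' y'] [/= h xx'] <-]; rewrite -xx'.
  apply: continuous_compact; first by apply: continuous_subspaceT => z; exact: cvg_snd.
  apply: compact_closedI => //.
  by apply: (@closed_comp _ _ (@fst R^o R^o) [set x]); [move=> z _; exact: cvg_fst|exact: closed_eq].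
move=> a b c; rewrite /xsection/= !inE; exact: cvx_vertical.
Qed.

Lemma measure_itvcc (a b : R) : a <= b -> mu `[a, b] = (b - a)%:E.
Proof.
move=> ab; rewrite lebesgue_measure_itv/= lte_fin.
by case: ltgtP ab => // ->; rewrite subrr.
Qed.

Lemma xsection_fiber_add A B x : xsection (fiber_add A B) x =
  [set y1 + y2 | y1 in xsection A x & y2 in xsection B x].
Proof.
apply/seteqP; split => y; rewrite /xsection/= inE.
  move=> [a [b [Aa Bb /= ->]]]; exists a; first by rewrite /= inE.
  by exists b => //; rewrite /= inE.
by move=> [a /=]; rewrite inE => Aa [b /=]; rewrite inE => Bb <-; exists a, b.
Qed.

Lemma mu_itv_add (a b c d : R) : a <= b -> c <= d ->
  mu [set y1 + y2 | y1 in `[a, b] & y2 in `[c, d]] = (mu `[a, b] + mu `[c, d])%E.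
Proof.
move=> ab cd; rewrite (_ : [set _ | _ in _ & _ in _] = `[(a + c), (b + d)]%classic).
  by rewrite !measure_itvcc ?lerD// -EFinD; congr EFin; ring.
apply/seteqP; split => y /=.
  by move=> [u /=]; rewrite in_itv/= => ? [v]; rewrite /= !in_itv/= => ? <-; lra.
rewrite in_itv/= => acy.
have [h|h] := leP (y - c) b.
  by exists (y - c); [rewrite /= in_itv/=; lra|exists c; rewrite /= ?in_itv/=; lra].
by exists b; [rewrite /= in_itv/=; lra|exists (y - b); rewrite /= ?in_itv/=; lra].
Qed.

(** The vertical sections are segments, whose lengths add.  The inequality
    can be strict because the sum is empty over a point where one of the two
    sections is empty. *)
Lemma area_fiber_add_le A B : compact A -> cvx A -> compact B -> cvx B ->
  (area (fiber_add A B) <= area A + area B)%E.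
Proof.
move=> cA vA cB vB.
have mA := compact_plane_measurable cA; have mB := compact_plane_measurable cB.
have mAB := compact_plane_measurable (fiber_add_compact cA cB).
rewrite /area /product_measure1 -ge0_integralD//=; last 2 first.
- exact: measurable_fun_xsection.
- exact: measurable_fun_xsection.
apply: ge0_le_integral => //=.
- exact: measurable_fun_xsection.
- by apply: emeasurable_funD; exact: measurable_fun_xsection.
move=> x _; rewrite xsection_fiber_add.
have [->|[a [b [ab ->]]]] := xsection_cvx x cA vA.
  by rewrite sum_set0l measure0 add0e.
have [->|[c [d [cd ->]]]] := xsection_cvx x cB vB.
  by rewrite sum_set0r measure0 adde0.
by rewrite mu_itv_add.
Qed.

Lemma area_fiber_add A B : compact A -> cvx A -> compact B -> cvx B ->
  (forall x, (exists y, A (x, y)) <-> (exists y, B (x, y))) ->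
  (area (fiber_add A B) = area A + area B)%E.
Proof.
move=> cA vA cB vB AB.
have mA := compact_plane_measurable cA; have mB := compact_plane_measurable cB.
rewrite /area /product_measure1 -ge0_integralD//=; last 2 first.
- exact: measurable_fun_xsection.
- exact: measurable_fun_xsection.
apply: eq_integral => x _ /=; rewrite xsection_fiber_add.
have := AB x.
have [A0|[a [b [ab EA]]]] := xsection_cvx x cA vA;
have [B0|[c [d [cd EB]]]] := xsection_cvx x cB vB => H.
- by rewrite A0 B0 sum_set0l measure0 add0e.
- have /(proj2 H)[y Axy] : exists y, B (x, y).
    exists c; have : `[c, d]%classic c by rewrite /= in_itv/= lexx.
    by rewrite -EB /xsection/= inE.
  by have h : xsection A x y by [exact: mem_set]; rewrite A0 in h.
- have /(proj1 H)[y Axy] : exists y, A (x, y).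
    exists a; have : `[a, b]%classic a by rewrite /= in_itv/= lexx.
    by rewrite -EA /xsection/= inE.
  by have h : xsection B x y by [exact: mem_set]; rewrite B0 in h.
- by rewrite EA EB mu_itv_add.
Qed.

End fiber_add.

(** * The first quadrant of the l_q ball *)

Section lq_quadrant.
Variable R : realType.
Implicit Types (p q a b s t : R).

Definition lq_quadrant q : set (plane R) :=
  [set w | [/\ 0 <= w.1, 0 <= w.2 & w.1 `^ q + w.2 `^ q <= 1]].

Lemma conjugate_gt1 p q : 1 < p -> p^-1 + q^-1 = 1 -> 1 < q.
Proof.
move=> p1 pq; have p0 : 0 < p by rewrite (lt_trans _ p1).
have ip : p^-1 < 1 by rewrite invf_lt1.
have ip0 : 0 < p^-1 by rewrite invr_gt0.
have iqE : q^-1 = 1 - p^-1 by rewrite -pq addrAC subrr add0r.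
by rewrite -[q]invrK invf_gt1 iqE ?subr_gt0// ltrBlDr ltrDl.
Qed.

Lemma conjugate_mulB1 p q : 1 < p -> p^-1 + q^-1 = 1 -> (p - 1) * q = p.
Proof.
move=> p1 pq; have q1 := conjugate_gt1 p1 pq.
have p0 : p != 0 by rewrite gt_eqF// (lt_trans _ p1).
have q0 : q != 0 by rewrite gt_eqF// (lt_trans _ q1).
have : (p^-1 + q^-1) * (p * q) = p * q by rewrite pq mul1r.
by rewrite mulrDl mulrA mulVf// mul1r mulrCA mulVf// mulr1 mulrBl mul1r => <-; ring.
Qed.

Definition lp_norm p a b := (a `^ p + b `^ p) `^ p^-1.

(** The equality case of Hoelder's inequality: the maximizing direction is
    (a^(p-1), b^(p-1)) up to a factor. *)
Lemma lp_norm_attained p q a b : 1 < p -> p^-1 + q^-1 = 1 -> 0 <= a -> 0 <= b ->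
  exists2 w, lq_quadrant q w & w.1 * a + w.2 * b = lp_norm p a b.
Proof.
move=> p1 pq a0 b0; have q1 := conjugate_gt1 p1 pq.
have p0 : 0 < p by rewrite (lt_trans _ p1).
have q0 : 0 < q by rewrite (lt_trans _ q1).
set N := lp_norm p a b.
have N0 : 0 <= N by exact: powR_ge0.
have NE : N `^ p = a `^ p + b `^ p.
  by rewrite /N /lp_norm -powRrM mulVf ?gt_eqF// powRr1// addr_ge0// powR_ge0.
have [Nz|Nz] := eqVneq N 0.
  have : a `^ p + b `^ p = 0 by rewrite -NE Nz powR0// gt_eqF.
  move=> /eqP; rewrite paddr_eq0 ?powR_ge0// => /andP[/eqP/powR_eq0_eq0 -> /eqP/powR_eq0_eq0 ->].
  exists (0, 0); last by rewrite /= !mul0r addr0.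
  by split => //=; rewrite powR0 ?gt_eqF// addr0 ler01.
have N1 : 0 < N by rewrite lt_neqAle eq_sym Nz.
have aN : 0 <= a / N by rewrite divr_ge0.
have bN : 0 <= b / N by rewrite divr_ge0.
have S1 : (a / N) `^ p + (b / N) `^ p = 1.
  have iN : 0 <= N^-1 by rewrite invr_ge0.
  by rewrite !powRM// -mulrDl -NE -powRM// mulfV// powR1 //.
exists ((a / N) `^ (p - 1), (b / N) `^ (p - 1)).
  split => /=; rewrite ?powR_ge0// -!powRrM (conjugate_mulB1 p1 pq) S1.
  exact: lexx.
have H x : 0 <= x -> (x / N) `^ (p - 1) * x = (x / N) `^ p * N.
  move=> x0; rewrite -[X in _ * X = _](divfK Nz) mulrA (mulrC (_ `^ _)).
  by rewrite mulr_powRB1 // divr_ge0.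
by rewrite /= !H // -mulrDl S1 mul1r.
Qed.

Lemma lq_quadrant_dual p q s t a b : 1 < p -> p^-1 + q^-1 = 1 -> 0 <= a -> 0 <= b ->
  lq_quadrant q (s, t) -> s * a + t * b <= lp_norm p a b.
Proof.
move=> p1 pq a0 b0 [/= s0 t0 st]; have q1 := conjugate_gt1 p1 pq.
have p0 : 0 < p by rewrite (lt_trans _ p1).
have q0 : 0 < q by rewrite (lt_trans _ q1).
rewrite (mulrC s) (mulrC t) (le_trans (hoelder2 a0 b0 s0 t0 p0 q0 pq))//.
rewrite ler_piMr ?powR_ge0//.
have <- : 1 `^ (q^-1) = 1 :> R by rewrite powR1.
by rewrite ge0_ler_powR ?nnegrE ?invr_ge0 ?addr_ge0 ?powR_ge0// ltW.
Qed.

(** The polar description of the l_q quadrant as an intersection of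
    half-planes, from which convexity and closedness are immediate. *)
Lemma lq_quadrantE p q : 1 < p -> p^-1 + q^-1 = 1 ->
  lq_quadrant q = [set w | [/\ 0 <= w.1, 0 <= w.2 &
    forall z, lq_quadrant p z -> w.1 * z.1 + w.2 * z.2 <= 1]].
Proof.
move=> p1 pq; have q1 := conjugate_gt1 p1 pq.
have qp : q^-1 + p^-1 = 1 by rewrite addrC.
have q0 : 0 < q by rewrite (lt_trans _ q1).
apply/seteqP; split => [[s t] Qst|[s t] [/= s0 t0 H]].
  have [/= s0 t0 _] := Qst; split => // -[a b] Qab /=.
  have [a0 b0 ab] := Qab.
  rewrite (le_trans (lq_quadrant_dual p1 pq a0 b0 Qst))//.
  have <- : 1 `^ (p^-1) = 1 :> R by rewrite powR1.
  by rewrite ge0_ler_powR ?nnegrE ?invr_ge0 ?addr_ge0 ?powR_ge0// ltW// (lt_trans _ p1).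
split => //=.
have [z Qz] := lp_norm_attained q1 qp s0 t0.
rewrite !(mulrC z.1) !(mulrC z.2) => E; have := H z Qz; rewrite E => N1.
have := @ge0_ler_powR R q (ltW q0) _ _ _ _ N1; rewrite !nnegrE powR_ge0 => /(_ isT ler01).
by rewrite /lp_norm -powRrM mulVf ?gt_eqF// powRr1 ?addr_ge0 ?powR_ge0// powR1.
Qed.

Lemma lq_quadrant_le1 q s t : 0 < q -> lq_quadrant q (s, t) -> s <= 1 /\ t <= 1.
Proof.
move=> q0 [/= s0 t0 st].
have H a : 0 <= a -> a `^ q <= 1 -> a <= 1.
  move=> a0; apply: contraTT; rewrite -!ltNge => a1.
  have <- : 1 `^ q = 1 :> R by rewrite powR1.
  by rewrite gt0_ltr_powR ?nnegrE.
by split; apply: H => //; rewrite (le_trans _ st)// ?lerDl ?lerDr powR_ge0.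
Qed.

Lemma lq_quadrant10 q : 0 < q -> lq_quadrant q (1, 0).
Proof. by move=> q0; split => //=; rewrite powR1 powR0 ?gt_eqF// addr0. Qed.

Lemma lq_quadrant_swap q s t : lq_quadrant q (s, t) -> lq_quadrant q (t, s).
Proof. by move=> [? ? ?]; split => //=; rewrite addrC. Qed.

Lemma lq_quadrant_mono q s t s' t' : 0 < q -> lq_quadrant q (s, t) ->
  0 <= s' <= s -> 0 <= t' <= t -> lq_quadrant q (s', t').
Proof.
move=> q0 [/= s0 t0 st] /andP[s'0 ss] /andP[t'0 tt]; split => //=.
by rewrite (le_trans _ st)// lerD// ge0_ler_powR ?nnegrE// ltW.
Qed.

Lemma continuous_lin1 (a b : R) : continuous (fun w : plane R => w.1 * a + w.2 * b : R).
Proof.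
move=> w; apply: cvgD; apply: cvgM; try exact: cvg_cst.
  exact: cvg_fst.
exact: cvg_snd.
Qed.

Lemma lq_quadrant_cvx p q : 1 < p -> p^-1 + q^-1 = 1 -> cvx (lq_quadrant q).
Proof.
move=> p1 pq; rewrite (lq_quadrantE p1 pq) => -[s t] [s' t'] l [/= s0 t0 H] [/= s'0 t'0 H'].
move=> /andP[l0 l1]; have l1' : 0 <= 1 - l by rewrite subr_ge0.
split => /=; rewrite ?addr_ge0 ?mulr_ge0// => z Qz.
have -> : (l * s + (1 - l) * s') * z.1 + (l * t + (1 - l) * t') * z.2 =
  l * (s * z.1 + t * z.2) + (1 - l) * (s' * z.1 + t' * z.2) by ring.
rewrite [leRHS](_ : 1 = l * 1 + (1 - l) * 1 :> R); last by ring.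
by rewrite lerD// ler_wpM2l// ?H ?H'.
Qed.

Lemma lq_quadrant_compact p q : 1 < p -> p^-1 + q^-1 = 1 -> compact (lq_quadrant q).
Proof.
move=> p1 pq; have q1 := conjugate_gt1 p1 pq.
have q0 : 0 < q by rewrite (lt_trans _ q1).
apply: (@subclosed_compact _ _ ((`[0, 1]%classic : set R^o) `*` (`[0, 1]%classic : set R^o))); last 2 first.
- by apply: compact_setX; exact: segment_compact.
- move=> [s t] Q; have [? ?] := lq_quadrant_le1 q0 Q; have [? ? _] := Q.
  by split; rewrite /= in_itv/=; apply/andP; split.
rewrite (lq_quadrantE p1 pq).
rewrite (_ : [set _ | _] = [set w | 0 <= w.1] `&` [set w | 0 <= w.2] `&`
   \bigcap_(z in lq_quadrant p) [set w | w.1 * z.1 + w.2 * z.2 <= 1]); last first.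
  by apply/seteqP; split => [w [? ? ?]//|w [[? ?] ?]].
have cl f (c : R) : continuous (f : plane R -> R) -> closed [set w | f w <= c].
  move=> cf; apply: (@closed_comp _ _ f [set x | x <= c]); last exact: closed_le.
  by move=> w _; exact: cf.
have cl' f (c : R) : continuous (f : plane R -> R) -> closed [set w | c <= f w].
  move=> cf; apply: (@closed_comp _ _ f [set x | c <= x]); last exact: closed_ge.
  by move=> w _; exact: cf.
apply: closedI; first apply: closedI.
- by apply: cl' => w; exact: cvg_fst.
- by apply: cl' => w; exact: cvg_snd.
- by apply: closed_bigI => z _; apply: cl; exact: continuous_lin1.
Qed.

End lq_quadrant.

(** * The combinations s k + t l *)

Section lp_comb.
Variable R : realType.
Implicit Types (p q a b s t : R) (K L : set (plane R)).

Definition lp_comb q K L : set (plane R) := [set v | exists w k l,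
  [/\ lq_quadrant q w, K k, L l & v = w.1 *: k + w.2 *: l]].

Lemma lp_comb_compact p q K L : 1 < p -> p^-1 + q^-1 = 1 ->
  compact K -> compact L -> compact (lp_comb q K L).
Proof.
move=> p1 pq cK cL.
pose f (z : plane R * (plane R * plane R)) : plane R :=
  z.1.1 *: z.2.1 + z.1.2 *: z.2.2.
have -> : lp_comb q K L = f @` (lq_quadrant q `*` (K `*` L)).
  apply/seteqP; split => [_ [w [k [l [Qw Kk Ll ->]]]]|_ [[w [k l]] [/= Qw [/= Kk Ll]] <-]].
    by exists (w, (k, l)).
  by exists w, k, l.
apply: continuous_compact; last first.
  by apply: compact_setX; [exact: lq_quadrant_compact p1 pq|exact: compact_setX].
apply: continuous_subspaceT => z; apply: cvgD.
  apply: cvgZ.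
    by apply: (continuous_comp (g := fst)); [exact: cvg_fst|exact: cvg_fst].
  by apply: (continuous_comp (g := fst)); [exact: cvg_snd|exact: cvg_fst].
apply: cvgZ.
  by apply: (continuous_comp (g := snd)); [exact: cvg_fst|exact: cvg_snd].
by apply: (continuous_comp (g := snd)); [exact: cvg_snd|exact: cvg_snd].
Qed.

(** The convexity of s K + t L, when s and t also vary, rests on
    s K + s' K = (s + s') K for convex K. *)
Lemma cvx_cone2 K (s s' : R) k k' : cvx K -> K 0 -> 0 <= s -> 0 <= s' -> K k -> K k' ->
  exists2 k'', K k'' & s *: k + s' *: k' = (s + s') *: k''.
Proof.
move=> cK K0 s0 s'0 Kk Kk'.
have [z|z] := eqVneq (s + s') 0.
  exists 0 => //; move: z => /eqP; rewrite paddr_eq0// => /andP[/eqP-> /eqP->].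
  by rewrite !scale0r !addr0 scale0r.
have ss : 0 < s + s' by rewrite lt_neqAle eq_sym z addr_ge0.
exists ((s / (s + s')) *: k + (1 - s / (s + s')) *: k').
  apply: cK => //; rewrite divr_ge0 ?addr_ge0//= ler_pdivrMr// mul1r lerDl//.
rewrite scalerDr !scalerA; congr (_ *: _ + _ *: _); by field.
Qed.

Lemma lp_comb_cvx p q K L : 1 < p -> p^-1 + q^-1 = 1 ->
  cvx K -> K 0 -> cvx L -> L 0 -> cvx (lp_comb q K L).
Proof.
move=> p1 pq cK K0 cL L0 _ _ r [w [k [l [Qw Kk Ll ->]]]] [w' [k' [l' [Qw' Kk' Ll' ->]]]] r01.
have [r0 r1] := andP r01; have r1' : 0 <= 1 - r by rewrite subr_ge0.
have [w10 w20 _] := Qw; have [w10' w20' _] := Qw'.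
have [k'' Kk'' Ek] := @cvx_cone2 K (r * w.1) ((1 - r) * w'.1) k k' cK K0
  (mulr_ge0 r0 w10) (mulr_ge0 r1' w10') Kk Kk'.
have [l'' Ll'' El] := @cvx_cone2 L (r * w.2) ((1 - r) * w'.2) l l' cL L0
  (mulr_ge0 r0 w20) (mulr_ge0 r1' w20') Ll Ll'.
exists (r *: w + (1 - r) *: w'), k'', l''; split => //.
  exact: (lq_quadrant_cvx p1 pq).
by rewrite /= -Ek -El !scalerDr !scalerA -!addrA; congr (_ + _); rewrite addrCA.
Qed.

(** The L_p difference body of [K], see [Lp_sumE]. *)
Definition lp_diff q K : set (plane R) := [set v | exists w k l,
  [/\ lq_quadrant q w, K k, K l & v = w.1 *: k - w.2 *: l]].

Lemma lp_diffE q K : lp_diff q K = lp_comb q K (opp_set K).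
Proof.
apply/seteqP; split => [_ [w [k [l [Qw Kk Kl ->]]]]|_ [w [k [_ [Qw Kk [l Kl <-] ->]]]]].
  by exists w, k, (- l); split => //; [exists l|rewrite scalerN].
by exists w, k, l; split => //; rewrite scalerN.
Qed.

Lemma opp_set_compact K : compact K -> compact (opp_set K).
Proof.
move=> cK; apply: continuous_compact => //; apply: continuous_subspaceT => z.
by apply: cvgN; exact: cvg_id.
Qed.

Lemma opp_set_cvx K : cvx K -> cvx (opp_set K).
Proof.
move=> cK _ _ t [k Kk <-] [l Kl <-] t01; exists (t *: k + (1 - t) *: l); first exact: cK.
by rewrite opprD !scalerN.
Qed.

Lemma opp_set0 K : K 0 -> opp_set K 0.
Proof. by move=> K0; exists 0 => //; rewrite oppr0. Qed.

Lemma lp_diff_compact p q K : 1 < p -> p^-1 + q^-1 = 1 ->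
  compact K -> compact (lp_diff q K).
Proof.
move=> p1 pq cK; rewrite lp_diffE; apply: (lp_comb_compact p1 pq) => //.
exact: opp_set_compact.
Qed.

Lemma lp_diff_cvx p q K : 1 < p -> p^-1 + q^-1 = 1 ->
  cvx K -> K 0 -> cvx (lp_diff q K).
Proof.
move=> p1 pq cK K0; rewrite lp_diffE; apply: (lp_comb_cvx p1 pq) => //.
  exact: opp_set_cvx.
exact: opp_set0.
Qed.

Lemma lp_diffS q K L : K `<=` L -> lp_diff q K `<=` lp_diff q L.
Proof.
by move=> KL _ [w [k [l [Qw Kk Kl ->]]]]; exists w, k, l; split => //; exact: KL.
Qed.

(** The same coefficients (s, t) serve for both summands.  The inclusion is
    strict in general, as different coefficients may be used on the right. *)
Lemma lp_diff_fiber_add q K L :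
  lp_diff q (fiber_add K L) `<=` fiber_add (lp_diff q K) (lp_diff q L).
Proof.
move=> _ [w [[k1 k2] [[l1 l2] [Qw [a [b [/= Ka Lb ->]]] [c [d [/= Kc Ld ->]]] ->]]]].
exists (w.1 * a - w.2 * c), (w.1 * b - w.2 * d); split => /=.
- by exists w, (k1, a), (l1, c).
- by exists w, (k1, b), (l1, d).
- by rewrite /GRing.scale/=; ring.
Qed.

Lemma linmapD a b c d u v : linmap a b c d (u + v) = linmap a b c d u + linmap a b c d v.
Proof. by rewrite /linmap; congr pair => /=; ring. Qed.

Lemma linmapZ a b c d (t : R) u : linmap a b c d (t *: u) = t *: linmap a b c d u.
Proof. by rewrite /linmap; congr pair => /=; rewrite /GRing.scale/=; ring. Qed.

Lemma linmapN a b c d u : linmap a b c d (- u) = - linmap a b c d u.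
Proof. by rewrite -scaleN1r linmapZ scaleN1r. Qed.

Lemma linmap_bij a b c d : a * d - b * c != 0 -> exists L' : plane R -> plane R,
  [/\ cancel (linmap a b c d) L', cancel L' (linmap a b c d) &
   exists a' b' c' d', L' = linmap a' b' c' d' /\ a' * d' - b' * c' != 0].
Proof.
move=> D0; set D := (_ - _) in D0 *.
exists (linmap (d / D) (- b / D) (- c / D) (a / D)); split.
- by move=> [x y]; rewrite /linmap/=; congr pair; rewrite /D; field.
- by move=> [x y]; rewrite /linmap/=; congr pair; rewrite /D; field.
- exists (d / D), (- b / D), (- c / D), (a / D); split => //.
  have -> : d / D * (a / D) - - b / D * (- c / D) = D^-1 by rewrite /D; field.
  by rewrite invr_eq0.
Qed.

Lemma linmap_continuous a b c d : continuous (linmap a b c d : plane R -> plane R).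
Proof.
apply: continuous_pair; move=> w; apply: cvgD; apply: cvgM; try exact: cvg_cst;
  by [exact: cvg_fst|exact: cvg_snd].
Qed.

Lemma preimage_linmap_compact a b c d K : a * d - b * c != 0 ->
  compact K -> compact (linmap a b c d @^-1` K).
Proof.
move=> D0 cK; have [L' [LK L'K [a' [b' [c' [d' [L'E _]]]]]]] := linmap_bij D0.
have -> : linmap a b c d @^-1` K = L' @` K.
  apply/seteqP; split => [v Kv|_ [v Kv <-]]; last by rewrite /= L'K.
  by exists (linmap a b c d v) => //; exact: LK.
apply: continuous_compact => //; apply: continuous_subspaceT.
by rewrite L'E; exact: linmap_continuous.
Qed.

Lemma preimage_linmap_cvx a b c d K : cvx K -> cvx (linmap a b c d @^-1` K).
Proof. by move=> cK x y t /= Kx Ky t01; rewrite linmapD !linmapZ; exact: cK. Qed.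

Lemma lp_diff_linmap q a b c d K : a * d - b * c != 0 ->
  lp_diff q (linmap a b c d @^-1` K) = linmap a b c d @^-1` (lp_diff q K).
Proof.
move=> D0; have [L' [LK L'K _]] := linmap_bij D0.
apply/seteqP; split => [_ [w [k [l [Qw Kk Kl ->]]]]|v [w [k [l [Qw Kk Kl E]]]]].
  exists w, (linmap a b c d k), (linmap a b c d l); split => //.
  by rewrite linmapD linmapN !linmapZ.
exists w, (L' k), (L' l); split; rewrite ?/preimage/= ?L'K//.
apply: (can_inj LK); rewrite E.
by rewrite linmapD linmapN !linmapZ !L'K.
Qed.

Lemma lp_diff_swap q K : lp_diff q (@swap _ _ @^-1` K) = @swap _ _ @^-1` (lp_diff q K).
Proof.
have -> : @swap _ _ = linmap 0 1 1 0 :> (plane R -> plane R).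
  by apply/funext => -[x y]; rewrite /linmap/swap/=; congr pair; ring.
by rewrite lp_diff_linmap// mul0r mul1r sub0r oppr_eq0 oner_eq0.
Qed.

End lp_comb.

(** * Boxes and parallelograms *)

Section boxes.
Variable R : realType.
Variables (p q : R).
Hypotheses (p_gt1 : 1 < p) (pq : p^-1 + q^-1 = 1).
Local Notation mu := (@lebesgue_measure R).
Local Notation Q := (lq_quadrant q).

Let q_gt0 : 0 < q.
Proof. by rewrite (lt_trans _ (conjugate_gt1 p_gt1 pq)). Qed.

(** Parametrized by the distances of its sides from the axes, so that the
    nonnegativity of the parameters says that the origin is in the box. *)
Definition box (b d b' d' : R) : set (plane R) :=
  [set v | [/\ - b <= v.1, v.1 <= d, - b' <= v.2 & v.2 <= d']].

Lemma boxE b d b' d' : box b d b' d' =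
  (`[- b, d]%classic : set R^o) `*` (`[- b', d']%classic : set R^o).
Proof.
apply/seteqP; split => -[x y] /=; rewrite /box/= !in_itv/=.
  by move=> [-> -> -> ->].
by move=> [/andP[-> ->] /andP[-> ->]].
Qed.

Lemma box_compact b d b' d' : compact (box b d b' d').
Proof. by rewrite boxE; apply: compact_setX; exact: segment_compact. Qed.

Lemma box_cvx b d b' d' : cvx (box b d b' d').
Proof.
move=> [x y] [x' y'] t [/= h1 h2 h3 h4] [/= k1 k2 k3 k4] t01.
have [t0 t1] := andP t01.
rewrite /box/= /GRing.scale/=; split; nra.
Qed.

Lemma area_box b d b' d' : - b <= d -> - b' <= d' ->
  area (box b d b' d') = ((d + b) * (d' + b'))%:E.
Proof.
move=> bd bd'; rewrite boxE area_setX//.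
by rewrite !measure_itvcc// -EFinM !opprK.
Qed.

Let lp_diff_measurable K : compact K -> measurable (lp_diff q K : set (mplane R)).
Proof. by move=> cK; apply: compact_plane_measurable; exact: (lp_diff_compact p_gt1 pq). Qed.

(** For (s, t) fixed, the two coordinates of s k - t l range independently
    over [-t, s]. *)
Lemma lp_diff_unitE : lp_diff q (box 0 1 0 1) =
  [set v | exists2 w, Q w & [/\ - w.2 <= v.1, v.1 <= w.1, - w.2 <= v.2 & v.2 <= w.1]].
Proof.
have H (s t x : R) : 0 <= s -> 0 <= t -> - t <= x -> x <= s ->
    exists k l, [/\ 0 <= k <= 1, 0 <= l <= 1 & x = s * k - t * l].
  move=> s0 t0 tx xs; have [x0|x0] := leP 0 x.
    have [s00|sn0] := eqVneq s 0.
      exists 0, 0; rewrite !lexx ler01; split => //.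
      by rewrite !mulr0 subr0; apply/eqP; rewrite eq_le x0 -s00 xs.
    have sp : 0 < s by rewrite lt_neqAle eq_sym sn0.
    exists (x / s), 0; rewrite lexx ler01 divr_ge0//= ler_pdivrMr// mul1r; split => //.
    by rewrite mulr0 subr0 mulrC divfK.
  have tp : 0 < t by rewrite -oppr_lt0 (le_lt_trans tx).
  exists 0, (- x / t); rewrite lexx ler01 divr_ge0 ?oppr_ge0 ?(ltW x0)//=.
  rewrite ler_pdivrMr// mul1r lerNl; split => //.
  by rewrite mulr0 sub0r mulrC divfK ?gt_eqF// opprK.
apply/seteqP; split => [_ [w [[k1 k2] [[l1 l2] [Qw /= [? ? ? ?] /= [? ? ? ?] ->]]]]|].
  have B (s t k l : R) : 0 <= s -> 0 <= t -> - 0 <= k -> k <= 1 -> - 0 <= l -> l <= 1 ->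
      - t <= s * k - t * l /\ s * k - t * l <= s.
    by rewrite oppr0 => *; split; nra.
  have [w1 w2 _] := Qw; exists w => //.
  have [? ?] : - w.2 <= w.1 * k1 - w.2 * l1 /\ w.1 * k1 - w.2 * l1 <= w.1 by exact: B.
  have [? ?] : - w.2 <= w.1 * k2 - w.2 * l2 /\ w.1 * k2 - w.2 * l2 <= w.1 by exact: B.
  by [].
move=> [x y] [w Qw /= [x1 x2 y1 y2]]; have [w1 w2 _] := Qw.
have [k1 [l1 [/andP[? ?] /andP[? ?] ->]]] := H _ _ _ w1 w2 x1 x2.
have [k2 [l2 [/andP[? ?] /andP[? ?] ->]]] := H _ _ _ w1 w2 y1 y2.
by exists w, (k1, k2), (l1, l2); split => //; rewrite /box/= oppr0; split.
Qed.

Local Open Scope ereal_scope.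

Lemma area_splitI (S T : set (mplane R)) : measurable S -> measurable T ->
  area S = area (S `&` T) + area (S `&` ~` T).
Proof.
move=> mS mT; rewrite /area -measureU//; last 3 first.
- exact: measurableI.
- by apply: measurableI => //; exact: measurableC.
- by rewrite setIACA setICr setI0.
by rewrite -setIUr setUCr setIT.
Qed.

Lemma area_null_x (S : set (mplane R)) : measurable S ->
  (forall v, S v -> v.1 = 0%R) -> area S = 0.
Proof.
move=> mS S0; apply/eqP; rewrite eq_le area_ge0 andbT.
apply: (@le_trans _ _ (area ([set 0%R] `*` setT : set (mplane R)))).
  apply: le_area => //; first exact: measurableX.
  by move=> v /S0 v0; split.
by rewrite area_setX// lebesgue_measure_set1 mul0e.
Qed.

Lemma area_null_y (S : set (mplane R)) : measurable S ->
  (forall v, S v -> v.2 = 0%R) -> area S = 0.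
Proof.
move=> mS S0; rewrite -area_swap//; apply: area_null_x.
  exact: measurable_preimage_swap.
by move=> v /S0.
Qed.

Let mQ : measurable (Q : set (mplane R)).
Proof. by apply: compact_plane_measurable; exact: lq_quadrant_compact p_gt1 pq. Qed.

Let mpos1 : measurable ([set v | 0 <= v.1]%R : set (mplane R)).
Proof.
rewrite (_ : [set _ | _] = `[0%R, +oo[ `*` setT); first exact: measurableX.
by apply/seteqP; split => v /=; rewrite in_itv/= andbT// => -[].
Qed.

Let mpos2 : measurable ([set v | 0 <= v.2]%R : set (mplane R)).
Proof.
rewrite (_ : [set _ | _] = setT `*` `[0%R, +oo[ ); first exact: measurableX.
by apply/seteqP; split => v /=; rewrite in_itv/= andbT// => -[].
Qed.

Let mneg2 : measurable ([set v | v.2 <= 0]%R : set (mplane R)).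
Proof.
rewrite (_ : [set _ | _] = setT `*` `]-oo, 0%R] ); first exact: measurableX.
by apply/seteqP; split => v /=; rewrite in_itv//= => -[].
Qed.

Let Qpos := Q `&` ~` [set v | v.2 <= 0]%R.

Let area_Qpos : area Qpos = area Q.
Proof.
rewrite [RHS](area_splitI mQ mneg2).
rewrite [X in _ = X + _](_ : _ = 0) ?add0e//; apply: area_null_y.
  exact: measurableI.
by move=> v [[_ v2 _] /= v2']; apply/eqP; rewrite eq_le v2 v2'.
Qed.

(** The area of the L_p difference body of the unit square. *)
Definition lq_cst : \bar R := 2%:E + 2%:E * area Q.

Lemma lq_cst_ge0 : 0 <= lq_cst.
Proof. by rewrite adde_ge0 ?mule_ge0 ?area_ge0 ?lee_fin. Qed.

(** In the quadrants where the coordinates have the same sign the squares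
    [-t, s]^2 fill a unit square (take (s, t) = (1, 0) or (0, 1)); in the two
    others they fill a reflected copy of [Q]. *)
Lemma area_lp_diff_unit : area (lp_diff q (box 0 1 0 1)) = lq_cst.
Proof.
have mE := lp_diff_measurable (@box_compact 0 1 0 1)%R.
rewrite (area_splitI mE mpos1).
rewrite (area_splitI (measurableI _ _ mE mpos1) mpos2).
rewrite (area_splitI (measurableI _ _ mE (measurableC mpos1)) mpos2).
rewrite lp_diff_unitE.
have mQp : measurable (Qpos : set (mplane R)).
  by apply: measurableI => //; exact: measurableC.
(* The quadrants are taken in the order (+,+), (+,-), (-,+), (-,-); the axes
   are assigned so that the pieces are disjoint, whence [Qpos] for [Q]. *)
rewrite (_ : _ `&` _ `&` _ = `[0%R, 1%R] `*` `[0%R, 1%R]); last first.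
  apply/seteqP; split => -[x y] /=; rewrite !in_itv/=.
    move=> [[[w Qw [/= _ xw _ yw]] -> ->]].
    have [w1 _] := @lq_quadrant_le1 _ _ w.1 w.2 q_gt0 Qw.
    by rewrite (le_trans xw w1) (le_trans yw w1).
  move=> [/andP[x0 x1] /andP[y0 y1]]; split => //; split => //.
  by exists (1, 0)%R; [exact: lq_quadrant10|rewrite /= oppr0; split].
rewrite (_ : _ `&` _ `&` ~` _ = linmap 1 0 0 (-1) @^-1` Qpos); last first.
  apply/seteqP; split => -[x y] /=; rewrite /linmap/= mul1r !mul0r add0r addr0 mulN1r.
    move=> [[[w Qw [/= _ xw yw _]] x0] /negP y0]; split.
      apply: (@lq_quadrant_mono _ q w.1 w.2) => //.
        by rewrite x0.
      by rewrite oppr_ge0 lerNl yw ltW// ltNge.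
    by rewrite /= oppr_le0; exact/negP.
  move=> [Qxy /negP]; rewrite /= oppr_le0 => y0; have [/= x0 _ _] := Qxy.
  split; last exact/negP; split => //.
  exists (x, - y)%R => //=; rewrite opprK.
  by split => //; [rewrite (le_trans _ x0)// ltW// ltNge|rewrite (le_trans _ x0)// ltW// ltNge].
rewrite (_ : _ `&` ~` _ `&` _ = linmap 0 1 (-1) 0 @^-1` Qpos); last first.
  apply/seteqP; split => -[x y] /=; rewrite /linmap/= mul1r !mul0r add0r addr0 mulN1r.
    move=> [[[w Qw [/= xw _ _ yw]] /negP x0] y0]; split.
      apply: (@lq_quadrant_mono _ q w.1 w.2) => //.
        by rewrite y0.
      by rewrite oppr_ge0 lerNl xw ltW// ltNge.
    by rewrite /= oppr_le0; exact/negP.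
  move=> [Qxy /negP]; rewrite /= oppr_le0 => x0; have [/= y0 _ _] := Qxy.
  split => //; split; last exact/negP.
  exists (y, - x)%R => //=; rewrite opprK.
  by split => //; [rewrite (le_trans _ y0)// ltW// ltNge|rewrite (le_trans _ y0)// ltW// ltNge].
rewrite (_ : _ `&` ~` _ `&` ~` _ = `[(-1)%R, 0%R[ `*` `[(-1)%R, 0%R[); last first.
  apply/seteqP; split => -[x y] /=; rewrite !in_itv/=.
    move=> [[[w Qw [/= xw _ yw _]] /negP x0 /negP y0]].
    have [_ w1] := @lq_quadrant_le1 _ _ w.1 w.2 q_gt0 Qw.
    by rewrite !ltNge x0 y0 !andbT (le_trans _ xw) ?(le_trans _ yw)// lerN2.
  rewrite !ltNge => -[/andP[x1 /negP x0] /andP[y1 /negP y0]]; split => //; split => //.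
  exists (0, 1)%R; first exact/lq_quadrant_swap/lq_quadrant10.
  by move: x0 y0 => /negP + /negP; rewrite -!ltNge => x0 y0; split => //=; exact: ltW.
have d1 : (1 * -1 - 0 * 0 != 0 :> R)%R by apply/eqP; lra.
have d2 : (0 * 0 - 1 * -1 != 0 :> R)%R by apply/eqP; lra.
rewrite !area_setX// (area_linmap d1 mQp) (area_linmap d2 mQp).
rewrite area_Qpos.
rewrite !lebesgue_measure_itv/= !lte_fin ltr01 ltrN10.
rewrite !(mul0r,mulr0,mul1r,subr0,sub0r,opprK,normrN,normr1,invr1,mul1e) -!EFinD -!EFinM.
rewrite !(sub0r,subr0,opprK,add0r,mul1r) /lq_cst.
rewrite (addeC (area Q) 1) addeACA; congr (_ + _).
by rewrite -[X in X + X]mul1e -ge0_muleDl ?lee_fin// -EFinD.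
Qed.

Let F b d b' d' := area (lp_diff q (box b d b' d')).

Lemma area_lp_diff_linmap (a b c d : R) K : (a * d - b * c != 0)%R -> compact K ->
  area (lp_diff q (linmap a b c d @^-1` K)) =
    (`|a * d - b * c|^-1)%:E * area (lp_diff q K).
Proof.
move=> D0 cK; rewrite lp_diff_linmap// area_linmap//.
exact: lp_diff_measurable.
Qed.

Let F_swap b d b' d' : F b d b' d' = F b' d' b d.
Proof.
rewrite /F -(area_swap (lp_diff_measurable (@box_compact b d b' d'))) -lp_diff_swap.
congr (area (lp_diff q _)); apply/seteqP.
by split => -[x y] [? ? ? ?]; split.
Qed.

Let F_opp b d b' d' : F b d b' d' = F d b b' d'.
Proof.
have D0 : (-1 * 1 - 0 * 0 != 0 :> R)%R by apply/eqP; lra.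
have := area_lp_diff_linmap D0 (@box_compact d b b' d').
rewrite (_ : `|_|^-1 = 1)%R; last by rewrite mul0r subr0 mulr1 normrN normr1 invr1.
rewrite mul1e /F => <-; congr (area (lp_diff q _)); apply/seteqP.
by split => -[x y]; rewrite /box/linmap/= => -[? ? ? ?]; split; lra.
Qed.

(** The box is the vertical sum of its parts below and above the axis. *)
Let F_split b d b' d' : (0 <= b)%R -> (0 <= d)%R -> (0 <= b')%R -> (0 <= d')%R ->
  F b d b' d' <= F b d b' 0%R + F b d 0%R d'.
Proof.
move=> b1 d1 b0 d0.
apply: (@le_trans _ _ (area (fiber_add (lp_diff q (box b d b' 0)%R) (lp_diff q (box b d 0%R d'))))).
  apply: le_area.
  - by apply: lp_diff_measurable; exact: box_compact.
  - apply: compact_plane_measurable.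
    by apply: fiber_add_compact; apply: (lp_diff_compact p_gt1 pq); exact: box_compact.
  apply: subset_trans (@lp_diff_fiber_add _ _ _ _); apply: lp_diffS.
  move=> [x y] [/= x1 x2 y1 y2].
  exists (Order.min y 0)%R, (Order.max y 0)%R; split => /=.
  - by split => //=; [rewrite le_min y1 oppr_le0 b0|rewrite ge_min lexx orbT].
  - by split => //=; [rewrite oppr0 le_max lexx orbT|rewrite ge_max y2 d0].
  - by rewrite addr_min_max addr0.
have c0 b3 d3 b2 d2 : (0 <= b3)%R -> (0 <= d3)%R -> (0 <= b2)%R -> (0 <= d2)%R -> box b3 d3 b2 d2 (0%R : plane R).
  by move=> *; split => //=; rewrite oppr_le0.
apply: area_fiber_add_le.
- by apply: (lp_diff_compact p_gt1 pq); exact: box_compact.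
- apply: (lp_diff_cvx p_gt1 pq); first exact: box_cvx.
  exact: c0.
- by apply: (lp_diff_compact p_gt1 pq); exact: box_compact.
- by apply: (lp_diff_cvx p_gt1 pq); [exact: box_cvx|exact: c0].
Qed.

(** A nondegenerate box with a vertex at the origin is a linear image of the
    unit square; a degenerate one has a degenerate difference body. *)
Let F_corner d d' : (0 <= d)%R -> (0 <= d')%R -> F 0%R d 0%R d' = (d * d')%:E * lq_cst.
Proof.
rewrite le_eqVlt => /predU1P[<-|d0].
  move=> _; rewrite mul0r mul0e; apply: area_null_x.
    by apply: lp_diff_measurable; exact: box_compact.
  move=> _ [w [[k1 k2] [[l1 l2] [_ [/= + + _ _] [/= + + _ _] ->]]]] /=.
  rewrite oppr0 => k0 k0' l0 l0'.
  have -> : k1 = 0%R by apply/eqP; rewrite eq_le k0 k0'.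
  have -> : l1 = 0%R by apply/eqP; rewrite eq_le l0 l0'.
  by rewrite !scaler0 subrr.
rewrite le_eqVlt => /predU1P[<-|d'0].
  rewrite mulr0 mul0e; apply: area_null_y.
    by apply: lp_diff_measurable; exact: box_compact.
  move=> _ [w [[k1 k2] [[l1 l2] [_ [/= _ _ + +] [/= _ _ + +] ->]]]] /=.
  rewrite oppr0 => k0 k0' l0 l0'.
  have -> : k2 = 0%R by apply/eqP; rewrite eq_le k0 k0'.
  have -> : l2 = 0%R by apply/eqP; rewrite eq_le l0 l0'.
  by rewrite !scaler0 subrr.
have D0 : (d^-1 * d'^-1 - 0 * 0 != 0 :> R)%R.
  by rewrite mul0r subr0 mulf_neq0// invr_eq0 gt_eqF.
have := area_lp_diff_linmap D0 (@box_compact 0 1 0 1)%R.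
rewrite (_ : `|_|^-1 = d * d')%R; last first.
  by rewrite mul0r subr0 -invfM normfV invrK gtr0_norm// mulr_gt0.
rewrite area_lp_diff_unit => <-.
congr (area (lp_diff q _)); apply/seteqP; split => -[x y]; rewrite /box/linmap/=;
  rewrite !mul0r add0r addr0 oppr0 !(mulrC d^-1)%R !(mulrC d'^-1)%R !ler_pdivrMr// !mul1r.
  by move=> [? ? ? ?]; split => //; rewrite divr_ge0// ltW.
by move=> [+ ? + ?]; rewrite !pmulr_lge0 ?invr_gt0.
Qed.

(** Splitting along both axes leaves four corner boxes, for which the bound is
    an equality, and whose areas add up to that of the box. *)
Lemma area_lp_diff_box b d b' d' : (0 <= b)%R -> (0 <= d)%R -> (0 <= b')%R -> (0 <= d')%R ->
  area (lp_diff q (box b d b' d')) <= lq_cst * area (box b d b' d').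
Proof.
move=> b0 d0 b'0 d'0; rewrite -/(F b d b' d') area_box; last 2 first.
- by rewrite (le_trans _ d0)// oppr_le0.
- by rewrite (le_trans _ d'0)// oppr_le0.
have F2 y y' : (0 <= y)%R -> (0 <= y')%R -> F b d y y' <= F 0%R b y y' + F 0%R d y y'.
  move=> y0 y'0; rewrite (F_swap b d) (F_swap _ b) (F_swap _ d).
  apply: (le_trans (F_split y0 y'0 b0 d0)).
  by rewrite (F_swap y y' b 0%R) (F_opp b) (F_swap 0%R b) lexx.
have E x y : (0 <= x)%R -> (0 <= y)%R -> F 0%R x y 0%R = (x * y)%:E * lq_cst.
  by move=> x0 y0; rewrite F_swap F_opp F_swap F_corner.
apply: (le_trans (F_split b0 d0 b'0 d'0)).
apply: (le_trans (leeD (F2 _ _ b'0 (lexx _)) (F2 _ _ (lexx _) d'0))).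
rewrite !E// !F_corner// -!ge0_muleDl ?lee_fin ?mulr_ge0// -?EFinD ?lee_fin ?addr_ge0 ?mulr_ge0//.
by rewrite muleC (_ : b * b' + d * b' + (b * d' + d * d') = (d + b) * (d' + b'))%R; last ring.
Qed.

Lemma area_lp_diff_parallelogram (l11 l12 l21 l22 b d b' d' : R) :
  (l11 * l22 - l12 * l21 != 0)%R ->
  (0 <= b)%R -> (0 <= d)%R -> (0 <= b')%R -> (0 <= d')%R ->
  area (lp_diff q (linmap l11 l12 l21 l22 @^-1` box b d b' d')) <=
    lq_cst * area (linmap l11 l12 l21 l22 @^-1` box b d b' d').
Proof.
move=> D0 b0 d0 b'0 d'0; rewrite area_lp_diff_linmap//; last exact: box_compact.
rewrite area_linmap//; last by apply: compact_plane_measurable; exact: box_compact.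
rewrite muleCA lee_wpmul2l// ?lee_fin ?invr_ge0//.
exact: area_lp_diff_box.
Qed.

Lemma area_lp_diff_parallelogram0 (l11 l12 l21 l22 : R) :
  (l11 * l22 - l12 * l21 != 0)%R ->
  area (lp_diff q (linmap l11 l12 l21 l22 @^-1` box 0 1 0 1)) =
    lq_cst * area (linmap l11 l12 l21 l22 @^-1` box 0 1 0 1).
Proof.
move=> D0; rewrite area_lp_diff_linmap//; last exact: box_compact.
rewrite area_linmap//; last by apply: compact_plane_measurable; exact: box_compact.
rewrite muleCA; congr (_ * _).
by rewrite area_lp_diff_unit area_box ?oppr0 ?ler01// !addr0 mulr1 mule1.
Qed.

End boxes.

(** * The Gamma function and the area of the l_q quadrant *)

Section layer_cake.
Variable R : realType.
Local Notation mu := (@lebesgue_measure R).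
Local Open Scope ereal_scope.

Lemma integral_expRN_tail (a : R) :
  \int[mu]_(r in `[a, +oo[) (expR (- r))%:E = (expR (- a))%:E.
Proof.
have dexp (x : R) : is_derive x 1%R (fun x : R => - expR (- x))%R (expR (- x)).
  by apply: is_derive_eq; rewrite /GRing.scale/=; ring.
rewrite (@ge0_continuous_FTC2y _ _ (fun x => - expR (- x))%R _ 0%R).
- by rewrite EFinN oppeK add0e.
- by move=> x _; exact: expR_ge0.
- apply: continuous_subspaceT => x; apply: continuous_comp; first exact: opp_continuous.
  exact: continuous_expR.
- by rewrite -oppr0; apply: cvgN; exact: cvgr_expR.
- by move=> x _; case: (dexp x).
- apply: cvg_at_right_filter; apply: cvgN; apply: continuous_comp; first exact: opp_continuous.
  exact: continuous_expR.
- by move=> x _; rewrite derive1E; exact: derive_val.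
Qed.

(** Write exp(-N x) as the integral of exp(-r) over r >= N x and exchange the
    integrals. *)
Lemma layer_cake d (T : measurableType d) (m : {sigma_finite_measure set T -> \bar R})
    (D : set T) (N : T -> R) : measurable D -> measurable_fun setT N ->
  (forall x, D x -> (0 <= N x)%R) ->
  \int[m]_(x in D) (expR (- N x))%:E =
  \int[mu]_(r in `[0%R, +oo[) ((expR (- r))%:E * m (D `&` [set x | N x <= r]%R)).
Proof.
move=> mD mN N0.
pose E : set (T * measurableTypeR R) := [set z | D z.1 /\ (N z.1 <= z.2)%R].
have mE : measurable E.
  rewrite (_ : E = (D `*` setT) `&` ((fun z => z.2 - N z.1)%R @^-1` `[0%R, +oo[)); last first.
    apply/seteqP; split => -[x r] /=; rewrite in_itv/= andbT subr_ge0.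
      by move=> [].
    by move=> [[]].
  apply: measurableI; first exact: measurableX.
  have mf : measurable_fun setT (fun z : T * measurableTypeR R => z.2 - N z.1)%R.
    apply: measurable_funB; first exact: measurable_snd.
    by apply: measurableT_comp => //; exact: measurable_fst.
  rewrite -[X in measurable X]setTI; exact: mf.
pose f (z : T * measurableTypeR R) := (\1_E z * expR (- z.2))%:E.
have mf : measurable_fun setT f.
  apply/measurable_EFinP; apply: measurable_funM; first exact: measurable_indic.
  apply: measurableT_comp; first exact: measurable_expR.
  by apply: measurableT_comp; [exact: oppr_measurable|exact: measurable_snd].
have f0 z : 0 <= f z by rewrite lee_fin mulr_ge0// expR_ge0.
transitivity (\int[m]_x \int[mu]_r f (x, r)).
  rewrite integral_mkcond; apply: eq_integral => x _.
  rewrite patchE; case: ifPn => xD.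
    rewrite -integral_expRN_tail integral_mkcond; apply: eq_integral => r _.
    rewrite patchE /f indicE.
    case: ifPn => [/set_mem|/negP Nr].
      rewrite /= in_itv/= andbT => Nr.
      by rewrite mem_set ?mul1r//; split => //; exact/set_mem.
    rewrite memNset ?mul0r// => -[_]/= xr; apply: Nr.
    by apply/mem_set; rewrite /= in_itv/= andbT.
  rewrite integral0_eq// => r _; rewrite /f indicE memNset ?mul0r// => -[/= Dx _].
  by move/negP: xD; apply; exact/mem_set.
rewrite (@fubini_tonelli _ _ _ _ _ m mu f mf f0) [RHS]integral_mkcond.
apply: eq_integral => r _; rewrite patchE.
case: ifPn => r0.
  have mI : measurable (D `&` [set x | N x <= r]%R).
    apply: measurableI => //; rewrite (_ : [set _ | _] = N @^-1` `]-oo, r]).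
      by rewrite -[X in measurable X]setTI; exact: mN.
    by apply/seteqP; split => x; rewrite /= in_itv.
  rewrite -[X in _ = _ * m X]setIT -integral_indic//.
  rewrite -ge0_integralZl//; last first.
    by apply/measurable_EFinP; exact: measurable_indic.
  apply: eq_integral => x _; rewrite /f -EFinM mulrC; congr (_ * _)%:E.
rewrite integral0_eq// => x _; rewrite /f indicE memNset ?mul0r// => -[/= Dx Nr].
move: r0; rewrite notin_setE/= in_itv/= andbT; apply.
exact: le_trans (N0 _ Dx) Nr.
Qed.

End layer_cake.

Section area_measure.
Variable R : realType.
Local Notation mu := (@lebesgue_measure R).
Local Open Scope ereal_scope.

(** [area] as a bundled sigma-finite measure, as required by [layer_cake]. *)
Definition area_measure : set (mplane R) -> \bar R := (mu \x mu).

HB.instance Definition _ := Measure.on area_measure.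

Let area_sigma_finite : sigma_finite setT area_measure.
Proof.
exists (fun n : nat => box n%:R n%:R n%:R n%:R : set (mplane R)).
  apply/seteqP; split => // -[x y] _.
  have H (z : R) : exists n : nat, (`|z| <= n%:R)%R.
    by exists (Num.truncn `|z|).+1; rewrite ltW// truncnS_gt.
  have [[n xn] [m ym]] := (H x, H y).
  exists (maxn n m) => //.
  have : (`|x| <= (maxn n m)%:R)%R by rewrite (le_trans xn)// ler_nat leq_maxl.
  have : (`|y| <= (maxn n m)%:R)%R by rewrite (le_trans ym)// ler_nat leq_maxr.
  by rewrite !ler_norml => /andP[? ?] /andP[? ?]; split.
move=> n; split; first by apply: compact_plane_measurable; exact: box_compact.
have n0 : (- n%:R <= n%:R :> R)%R by rewrite (@le_trans _ _ 0%R)// oppr_le0.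
by have := area_box n0 n0; rewrite /area_measure /area => ->; rewrite ltry.
Qed.

HB.instance Definition _ := Measure_isSigmaFinite.Build _ _ _ area_measure area_sigma_finite.

End area_measure.

Section gamma_area.
Variables (R : realType) (p q : R).
Hypotheses (p_gt1 : 1 < p) (pq : p^-1 + q^-1 = 1).
Local Notation mu := (@lebesgue_measure R).
Local Open Scope ereal_scope.

Let q_gt1 : (1 < q)%R := conjugate_gt1 p_gt1 pq.
Let q_gt0 : (0 < q)%R. Proof. by rewrite (lt_trans _ q_gt1). Qed.

Let mpow (e : R) : measurable_fun setT (fun s : measurableTypeR R => (s `^ e)%R).
Proof. exact: measurable_powR. Qed.

Let mexpNpow : measurable_fun setT (fun s : measurableTypeR R => (expR (- (s `^ q)))%R).
Proof.
apply: measurableT_comp; first exact: measurable_expR.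
by apply: measurableT_comp; [exact: oppr_measurable|exact: mpow].
Qed.

Let powK (r : R) : (0 <= r)%R -> ((r `^ q) `^ q^-1 = r)%R.
Proof. by move=> r0; rewrite -powRrM mulfV ?gt_eqF// powRr1. Qed.

Let powVK (r : R) : (0 <= r)%R -> ((r `^ q^-1) `^ q = r)%R.
Proof. by move=> r0; rewrite -powRrM mulVf ?gt_eqF// powRr1. Qed.

Let pow_le (s r : R) : (0 <= s)%R -> (0 <= r)%R -> (s `^ q <= r)%R = (s <= r `^ q^-1)%R.
Proof.
move=> s0 r0; apply/idP/idP => h.
  by rewrite -[leLHS]powK// ge0_ler_powR ?nnegrE ?powR_ge0// invr_ge0 ltW.
by rewrite -[leRHS]powVK// ge0_ler_powR ?nnegrE ?powR_ge0// ltW.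
Qed.

(** The integral of Gamma(1 + e) in the extended reals, where the integrals can
    be exchanged before they are known to converge. *)
Definition Gammae (e : R) := \int[mu]_(r in `]0%R, +oo[) (r `^ e * expR (- r))%:E.

Let Gammae_itv (e : R) : Gammae e = \int[mu]_(r in `[0%R, +oo[) (expR (- r) * r `^ e)%:E.
Proof.
rewrite /Gammae integral_itv_obnd_cbnd.
  by apply: eq_integral => r _; rewrite mulrC.
apply/measurable_EFinP; apply: measurable_funTS; apply: measurable_funM; first exact: mpow.
by apply: measurableT_comp; [exact: measurable_expR|exact: oppr_measurable].
Qed.

Let J := \int[mu]_(s in `[0%R, +oo[) (expR (- (s `^ q)))%:E.

(** The level set {s >= 0 : s^q <= r} has length r^(1/q). *)
Let J_Gamma : J = Gammae q^-1.
Proof.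
rewrite /J (layer_cake mu _ (mpow q)) //; last by move=> s _; exact: powR_ge0.
rewrite Gammae_itv; apply: eq_integral => r; rewrite inE/= in_itv/= andbT => r0.
rewrite (_ : _ `&` _ = `[0%R, (r `^ q^-1)%R]%classic).
  by rewrite measure_itvcc ?powR_ge0// subr0.
apply/seteqP; split => s /=; rewrite !in_itv/= andbT.
  by move=> [s0]; rewrite pow_le// s0 => ->.
by move=> /andP[s0 sr]; rewrite pow_le.
Qed.

(** The level set {s^q + t^q <= r} in the first quadrant is r^(1/q) [Q], of
    area r^(2/q) |Q|. *)
Let J2_Gamma : J * J = area (lq_quadrant q) * Gammae (2 / q).
Proof.
pose D : set (mplane R) := `[0%R, +oo[ `*` `[0%R, +oo[.
have mD : measurable D by exact: measurableX.
pose N (z : mplane R) := (z.1 `^ q + z.2 `^ q)%R.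
have mN : measurable_fun setT N.
  apply: measurable_funD.
    by apply: (measurableT_comp (mpow q)); exact: measurable_fst.
  by apply: (measurableT_comp (mpow q)); exact: measurable_snd.
have mg : measurable_fun setT (fun z : mplane R => (expR (- N z))%:E).
  apply/measurable_EFinP; apply: measurableT_comp; first exact: measurable_expR.
  by apply: measurableT_comp; [exact: oppr_measurable|exact: mN].
pose h := (fun s : measurableTypeR R => (expR (- (s `^ q)))%:E) \_ `[0%R, +oo[.
have h0 s : 0 <= h s by rewrite /h patchE; case: ifPn => // _; rewrite lee_fin expR_ge0.
have mh : measurable_fun setT h.
  apply/(measurable_restrictT _ _).1 => //; apply: measurable_funTS.
  exact/measurable_EFinP.
have Jh : J = \int[mu]_s h s by rewrite /J integral_mkcond.
have J0 : 0 <= J by apply: integral_ge0 => s _; rewrite lee_fin expR_ge0.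
transitivity (\int[@area_measure R]_(z in D) (expR (- N z))%:E).
  rewrite integral_mkcond [RHS]fubini_tonelli1; last 2 first.
  - apply/(measurable_restrictT _ _).1 => //; exact: measurable_funTS.
  - by move=> z; rewrite patchE; case: ifPn => // _; rewrite lee_fin expR_ge0.
  rewrite {1}Jh -ge0_integralZr//; apply: eq_integral => s _.
  rewrite /fubini_F Jh -ge0_integralZl//; apply: eq_integral => t _.
  rewrite /h !patchE in_setX /N/=; case: ifPn => _; case: ifPn => _ /=;
    rewrite ?mul0e ?mule0//.
  by rewrite -EFinM -expRD opprD.
rewrite layer_cake //; last first.
  by move=> z _; rewrite addr_ge0// powR_ge0.
rewrite Gammae_itv -ge0_integralZl//; last 2 first.
- apply/measurable_EFinP; apply: measurable_funTS; apply: measurable_funM; last exact: mpow.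
  by apply: measurableT_comp; [exact: measurable_expR|exact: oppr_measurable].
- by move=> r _; rewrite lee_fin mulr_ge0 ?expR_ge0 ?powR_ge0.
apply: eq_integral => r; rewrite inE/= in_itv/= andbT => r0.
rewrite EFinM muleCA; congr (_ * _); rewrite muleC.
change (area (D `&` [set z | N z <= r]%R) = (r `^ (2 / q))%:E * area (lq_quadrant q)).
have mDN : measurable (D `&` [set z | N z <= r]%R).
  apply: measurableI => //; rewrite (_ : [set _ | _] = N @^-1` `]-oo, r]).
    by rewrite -[X in measurable X]setTI; exact: mN.
  by apply/seteqP; split => x; rewrite /= in_itv.
have [rz|rn0] := eqVneq r 0%R.
  rewrite rz powR0 ?mul0e; last by rewrite gt_eqF// divr_gt0.
  apply: area_null_x; first by rewrite -rz.
  move=> [s t] [_]; rewrite /N/= => st; apply: (@powR_eq0_eq0 _ _ q); apply/eqP.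
  by rewrite eq_le powR_ge0 andbT (le_trans _ st)// lerDl powR_ge0.
have rp : (0 < r)%R by rewrite lt_neqAle eq_sym rn0.
set b := (r `^ (- q^-1))%R.
have ip : (0 < b)%R by rewrite powR_gt0.
have D0 : (b * b - 0 * 0 != 0)%R by rewrite mul0r subr0 mulf_neq0// gt_eqF.
have E (s : R) : (0 <= s)%R -> ((b * s) `^ q = r^-1 * s `^ q)%R.
  move=> s0; rewrite powRM ?powR_ge0// /b -powRrM mulNr mulVf ?gt_eqF// powR_inv1 ?ltW//.
rewrite (_ : _ `&` _ = linmap b 0 0 b @^-1` lq_quadrant q).
  rewrite area_linmap//; last by apply: compact_plane_measurable; exact: lq_quadrant_compact p_gt1 pq.
  congr (_%:E * _).
  rewrite mul0r subr0 gtr0_norm ?mulr_gt0// /b -powRD; last by rewrite rn0 implybT.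
  rewrite -powRN; congr (r `^ _)%R; field.
  by rewrite gt_eqF.
apply/seteqP; split => -[s t]; rewrite /D/linmap/N/= !in_itv/= !andbT !mul0r addr0 add0r.
  move=> [[s0 t0] st]; split => /=; [exact: mulr_ge0 (ltW ip) s0|exact: mulr_ge0 (ltW ip) t0|].
  by rewrite !E// -mulrDr mulrC ler_pdivrMr// mul1r.
move=> []/=; rewrite !pmulr_rge0// => s0 t0; by rewrite !E// -mulrDr mulrC ler_pdivrMr// mul1r.
Qed.

Lemma Gamma_area : area (lq_quadrant q) * Gammae (2 / q) = Gammae q^-1 * Gammae q^-1.
Proof. by have := J2_Gamma; rewrite J_Gamma => /esym. Qed.

(** s^q >= s - 1 for s >= 0. *)
Let J_lty : J < +oo.
Proof.
apply: (@le_lt_trans _ _ (\int[mu]_(s in `[0%R, +oo[) ((expR 1)%:E * (expR (- s))%:E))).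
  apply: ge0_le_integral => //.
  - by apply/measurable_EFinP; exact: measurable_funTS.
  - apply/measurable_EFinP; apply: measurable_funTS; apply: measurable_funM => //.
    by apply: measurableT_comp; [exact: measurable_expR|exact: oppr_measurable].
  - move=> s; rewrite /= in_itv/= andbT => s0.
    rewrite -EFinM -expRD lee_fin ler_expR.
    have [s1|s1] := leP s 1%R.
      by rewrite (@le_trans _ _ 0%R)// ?oppr_le0 ?powR_ge0// subr_ge0.
    rewrite lerNl opprB (@le_trans _ _ s) ?gerBl//.
    by rewrite le1r_powR ?ltW.
rewrite ge0_integralZl//; last first.
  apply/measurable_EFinP; apply: measurable_funTS.
  by apply: measurableT_comp; [exact: measurable_expR|exact: oppr_measurable].
by rewrite integral_expRN_tail -EFinM ltry.
Qed.

Let J_gt0 : 0 < J.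
Proof.
apply: (@lt_le_trans _ _ (\int[mu]_(s in `[0%R, 1%R]) (expR (- 1))%:E)).
  rewrite integral_cst//= (measure_itvcc (ler01 : 0 <= 1 :> R)%R) subr0 mule1.
  by rewrite lte_fin expR_gt0.
apply: (@le_trans _ _ (\int[mu]_(s in `[0%R, 1%R]) (expR (- (s `^ q)))%:E)).
  apply: ge0_le_integral => //.
  - by apply/measurable_EFinP; exact: measurable_funTS.
  - move=> s; rewrite /= in_itv/= => /andP[s0 s1]; rewrite lee_fin ler_expR lerN2.
    have <- : (1 `^ q = 1 :> R)%R by rewrite powR1.
    by rewrite ge0_ler_powR ?nnegrE// ltW.
apply: ge0_subset_integral => //.
- by apply/measurable_EFinP; exact: measurable_funTS.
by move=> s; rewrite /= !in_itv/= andbT => /andP[].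
Qed.

Lemma area_lq_quadrant_gt0 : 0 < area (lq_quadrant q).
Proof.
apply: (@lt_le_trans _ _ (area (box 0 2^-1 0 2^-1)%R)).
  by rewrite area_box ?oppr0 ?invr_ge0// !addr0 lte_fin mulr_gt0 ?invr_gt0.
apply: le_area.
- by apply: compact_plane_measurable; exact: box_compact.
- by apply: compact_plane_measurable; exact: lq_quadrant_compact p_gt1 pq.
move=> [s t] [/= + s1 + t1]; rewrite !oppr0 => s0 t0; split => //=.
have H (x : R) : (0 <= x)%R -> (x <= 2^-1)%R -> (x `^ q <= 2^-1)%R.
  rewrite le_eqVlt => /predU1P[<- _|x0 x1]; first by rewrite powR0 ?gt_eqF.
  have x1' := x1.
  apply: le_trans x1; apply: ge1r_powR; last exact: ltW.
  by rewrite x0/= (le_trans x1')// invf_le1// ler1n.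
by rewrite [leRHS](_ : 1 = 2^-1 + 2^-1)%R ?lerD ?H//; lra.
Qed.

Lemma area_lq_quadrant_fin : area (lq_quadrant q) < +oo.
Proof.
apply: (@le_lt_trans _ _ (area (box 0 1 0 1)%R)); last by rewrite area_box ?oppr0 ?ltry.
apply: le_area.
- by apply: compact_plane_measurable; exact: lq_quadrant_compact p_gt1 pq.
- by apply: compact_plane_measurable; exact: box_compact.
move=> [s t] Qst; have [? ? _] := Qst.
by have [? ?] := lq_quadrant_le1 q_gt0 Qst; split => //=; rewrite oppr0.
Qed.

Let GammaE (e : R) : Gamma (1 + e) = fine (Gammae e).
Proof.
rewrite /Gamma /Rintegral /Gammae; congr fine; apply: eq_integral => r _.
by rewrite addrAC subrr add0r.
Qed.

(** Since Gamma(1 + 1/q) and |Q| are finite and positive, [Gamma_area] forces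
    Gamma(1 + 2/q) to be finite and nonzero, and it can be divided by. *)
Lemma lq_cstE :
  lq_cst q = (2 * Gamma (1 + 1 / q) ^+ 2 / Gamma (1 + 2 / q) + 2)%:E.
Proof.
rewrite !GammaE mul1r.
have := Gamma_area; have := J_gt0; have := J_lty; rewrite J_Gamma.
rewrite /lq_cst; have := area_lq_quadrant_fin; have := area_lq_quadrant_gt0.
have : 0 <= Gammae (2 / q).
  by apply: integral_ge0 => r _; rewrite lee_fin mulr_ge0 ?powR_ge0 ?expR_ge0.
case: (area _) => [a| |]//; case: (Gammae q^-1) => [j| |]//.
case: (Gammae (2 / q)) => [g| |]//; rewrite /= ?lee_fin ?lte_fin.
  move=> g0 a0 _ _ j0 [] agj.
  have gn0 : g != 0%R.
    by apply/eqP => gz; move: agj; rewrite gz mulr0 => /esym/eqP; rewrite mulf_eq0 gt_eqF.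
  rewrite -EFinM -EFinD; congr EFin.
  by rewrite expr2 -agj mulrA mulfK// addrC.
by move=> _ a0 _ _ _; rewrite gt0_muley// lte_fin.
Qed.

End gamma_area.

(** * The L_p sum *)

Section support.
Variable R : realType.
Implicit Types (K L M N : set (plane R)) (x v : plane R).

Lemma inner_prod_continuous x : continuous (fun v : plane R => inner_prod x v : R).
Proof.
move=> v; rewrite /inner_prod; apply: cvgD; apply: cvgM; try exact: cvg_cst.
  exact: cvg_fst.
exact: cvg_snd.
Qed.

Lemma support_funP K x : K !=set0 -> compact K ->
  (exists2 k, K k & support_fun K x = inner_prod x k) /\
  (forall k, K k -> inner_prod x k <= support_fun K x).
Proof.
move=> K0 cK.
have [k /set_mem Kk kmax] := compact_EVT_max K0 cK
  (continuous_subspaceT (@inner_prod_continuous x)).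
have ub : ubound [set inner_prod x k | k in K] (inner_prod x k).
  by move=> _ [l Kl <-]; apply: kmax; exact: mem_set.
have le l : K l -> inner_prod x l <= support_fun K x.
  by move=> Kl; apply: ub_le_sup; [exists (inner_prod x k)|exists l].
split => //; exists k => //; apply/eqP; rewrite eq_le le// andbT.
by apply: ge_sup => //; exists (inner_prod x k), k.
Qed.

Lemma support_fun_ge0 K x : K 0 -> compact K -> 0 <= support_fun K x.
Proof.
move=> K0 cK; have [_ /(_ _ K0)] := support_funP x (ex_intro _ _ K0) cK.
by rewrite /inner_prod/= !mulr0 addr0.
Qed.

Lemma inner_prodDr x u v : inner_prod x (u + v) = inner_prod x u + inner_prod x v.
Proof. by rewrite /inner_prod/=; ring. Qed.

Lemma inner_prodZr x (t : R) v : inner_prod x (t *: v) = t * inner_prod x v.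
Proof. by rewrite /inner_prod/= /GRing.scale/=; ring. Qed.

Lemma support_fun_lp_comb p q K L x : 1 < p -> p^-1 + q^-1 = 1 ->
  compact K -> compact L -> K 0 -> L 0 ->
  support_fun (lp_comb q K L) x = lp_norm p (support_fun K x) (support_fun L x).
Proof.
move=> p1 pq cK cL K0 L0.
have cM := lp_comb_compact p1 pq cK cL.
have hK0 := support_fun_ge0 x K0 cK; have hL0 := support_fun_ge0 x L0 cL.
have [[k Kk Ek] Kmax] := support_funP x (ex_intro _ _ K0) cK.
have [[l Ll El] Lmax] := support_funP x (ex_intro _ _ L0) cL.
have [w Qw Ew] := lp_norm_attained p1 pq hK0 hL0.
have Mv : lp_comb q K L (w.1 *: k + w.2 *: l) by exists w, k, l.
have [[_ [w' [k' [l' [Qw' Kk' Ll' ->]]]] EM] Mmax] := support_funP x (ex_intro _ _ Mv) cM.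
apply/eqP; rewrite eq_le; apply/andP; split.
  have [w10 w20 _] := Qw'.
  rewrite EM inner_prodDr !inner_prodZr.
  rewrite (le_trans _ (lq_quadrant_dual p1 pq hK0 hL0 Qw'))//.
  by rewrite lerD// ler_wpM2l// ?Kmax// Lmax.
by rewrite -Ew Ek El -!inner_prodZr -inner_prodDr Mmax.
Qed.

(** If [v] is in [M] but not in [N], and [n0] is the point of [N] nearest to
    [v], then [d = v - n0] separates: on [N] the functional [d] is at most its
    value at [n0], which is smaller than its value at [v]. *)
Lemma support_fun_inj M N : M !=set0 -> N !=set0 -> compact M -> compact N -> cvx N ->
  (forall x, support_fun M x = support_fun N x) -> M `<=` N.
Proof.
move=> M0 N0 cM cN vN MN v Mv; apply: contrapT => Nv.
pose f (n : plane R) : R := (v.1 - n.1) ^+ 2 + (v.2 - n.2) ^+ 2.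
have cf : continuous f.
  have c1 : continuous (fun n : plane R => v.1 - n.1 : R).
    by move=> n; apply: cvgB; [exact: cvg_cst|exact: cvg_fst].
  have c2 : continuous (fun n : plane R => v.2 - n.2 : R).
    by move=> n; apply: cvgB; [exact: cvg_cst|exact: cvg_snd].
  by move=> n; apply: cvgD; apply: cvgM; by [exact: c1|exact: c2].
have [n0 /set_mem Nn0 nmin] := compact_EVT_min N0 cN (continuous_subspaceT cf).
set d := v - n0.
have fd : f n0 = inner_prod d d by rewrite /f /inner_prod /d/= !expr2.
have d0 : 0 < inner_prod d d.
  rewrite lt_neqAle /inner_prod -!expr2 addr_ge0 ?sqr_ge0// andbT eq_sym.
  apply/eqP => /eqP; rewrite paddr_eq0 ?sqr_ge0// !sqrf_eq0 => /andP[/eqP d1 /eqP d2].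
  apply: Nv; suff -> : v = n0 by [].
  by apply: subr0_eq; rewrite -/d (surjective_pairing d) d1 d2.
have sep n : N n -> inner_prod d n <= inner_prod d n0.
  move=> Nn; rewrite leNgt; apply/negP; rewrite -subr_gt0.
  set e := (_ - _) => e0.
  pose s : R := (n.1 - n0.1) ^+ 2 + (n.2 - n0.2) ^+ 2.
  have s0 : 0 <= s by rewrite addr_ge0 ?sqr_ge0.
  have es : 0 < e + s by rewrite ltr_pwDl.
  pose t := e / (e + s).
  have t0 : 0 < t by rewrite divr_gt0.
  have t1 : t <= 1 by rewrite ler_pdivrMr// mul1r lerDl.
  have /mem_set/nmin : N (t *: n + (1 - t) *: n0) by apply: vN => //; rewrite ltW.
  rewrite leNgt => /negP; apply.
  (* Moving from [n0] towards [n] changes the squared distance to [v] by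
     - 2 t e + t^2 s, which is negative for this [t] since t s < e + e. *)
  have -> : f (t *: n + (1 - t) *: n0) = f n0 - t * (2 * e - t * s).
    rewrite /f /e /s /inner_prod /d/= /GRing.scale/=; ring.
  rewrite gtrBl mulr_gt0// subr_gt0.
  rewrite (@le_lt_trans _ _ e)//; last by rewrite mulr_natl mulr2n ltrDl.
  by rewrite /t mulrAC ler_pdivrMr// ler_wpM2l ?(ltW e0)// lerDr ltW.
have [[n Nn En] _] := support_funP d N0 cN.
have [_ /(_ _ Mv)] := support_funP d M0 cM.
rewrite MN En leNgt => /negP; apply.
rewrite (le_lt_trans (sep _ Nn))// -subr_gt0.
suff -> : inner_prod d v - inner_prod d n0 = inner_prod d d by [].
by rewrite /inner_prod /d/=; ring.
Qed.

(** The chosen set and [lp_comb q K L] have the same support function, which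
    determines a compact convex set. *)
Lemma Lp_sumE p q K L : 1 < p -> p^-1 + q^-1 = 1 ->
  compact K -> compact L -> cvx K -> cvx L -> K 0 -> L 0 ->
  Lp_sum p K L = lp_comb q K L.
Proof.
move=> p1 pq cK cL vK vL K0 L0.
have cM := lp_comb_compact p1 pq cK cL.
have vM := lp_comb_cvx p1 pq vK K0 vL L0.
have M0 : lp_comb q K L !=set0.
  exists (1 *: 0 + 0 *: 0), (1, 0), 0, 0; split => //; apply: lq_quadrant10.
  by rewrite (lt_trans _ (conjugate_gt1 p1 pq)).
have SM : is_Lp_sum p K L (lp_comb q K L).
  split => //; first exact/convex_setP.
  by move=> x; exact: support_fun_lp_comb.
have [N0 cN /convex_setP vN SN] := getPex (ex_intro _ _ SM).
have [_ _ _ SM'] := SM.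
apply/seteqP; split; apply: support_fun_inj => // x; by rewrite SN SM'.
Qed.

End support.

(** * Bodies between two graphs *)

Section bands.
Variable R : realType.
Variables (p q : R).
Hypotheses (p_gt1 : 1 < p) (pq : p^-1 + q^-1 = 1).

(** The common shadow [-1, 1] makes areas add under [fiber_add]; the origin in
    [K] makes the difference body convex. *)
Definition lp_good (K : set (plane R)) :=
  [/\ compact K, cvx K, K 0, (forall x, (exists y, K (x, y)) <-> -1 <= x <= 1) &
      (area (lp_diff q K) <= lq_cst q * area K)%E].

Lemma lp_good_fiber_add K L : lp_good K -> lp_good L -> lp_good (fiber_add K L).
Proof.
move=> [cK vK K0 pK gK] [cL vL L0 pL gL]; split.
- exact: fiber_add_compact.
- exact: fiber_add_cvx.
- by exists 0, 0; split => //; rewrite addr0.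
- move=> x; split=> [[y [a [b [/= Ka Lb _]]]]|x1]; first by apply/pK; exists a.
  have [a Ka] := (pK x).2 x1; have [b Lb] := (pL x).2 x1.
  by exists (a + b), a, b.
- rewrite area_fiber_add//; last by move=> x; rewrite pK pL.
  rewrite ge0_muleDr ?area_ge0//; apply: le_trans (leeD gK gL).
  apply: (@le_trans _ _ (area (fiber_add (lp_diff q K) (lp_diff q L)))).
    apply: le_area; last exact: lp_diff_fiber_add.
    + apply: compact_plane_measurable; apply: (lp_diff_compact p_gt1 pq).
      exact: fiber_add_compact.
    + apply: compact_plane_measurable.
      by apply: fiber_add_compact; exact: (lp_diff_compact p_gt1 pq).
  by apply: area_fiber_add_le; by [exact: (lp_diff_compact p_gt1 pq)|exact: (lp_diff_cvx p_gt1 pq)].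
Qed.

(** The body with centre of symmetry (0, a) whose upper boundary is a + g. *)
Definition band (a : R) (g : R -> R) : set (plane R) :=
  [set v | [/\ -1 <= v.1, v.1 <= 1, a - g (- v.1) <= v.2 & v.2 <= a + g v.1]].

(** The vertical sections of a band are nonempty. *)
Definition nonneg_width (g : R -> R) := forall x, -1 <= x <= 1 -> 0 <= g x + g (- x).

Lemma bandD a1 a2 g1 g2 : nonneg_width g1 -> nonneg_width g2 ->
  band (a1 + a2) (g1 \+ g2) = fiber_add (band a1 g1) (band a2 g2).
Proof.
move=> w1 w2; apply/seteqP; split => -[x y]; last first.
  by move=> [y1 [y2 [[/= ? ? ? ?] [/= ? ? ? ?] ->]]]; split => //=; lra.
move=> [/= x1 x2 h1 h2].
have x12 : -1 <= x <= 1 by rewrite x1.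
have {}w1 := w1 x x12; have {}w2 := w2 x x12.
have [h|h] := leP (y - (a2 + g2 x)) (a1 - g1 (- x)).
  exists (a1 - g1 (- x)), (y - (a1 - g1 (- x))); split; rewrite /band/=; try split => //; lra.
exists (y - (a2 + g2 x)), (a2 + g2 x); split; rewrite /band/=; try split => //; lra.
Qed.

(** The constant contributes the area of the box [-1, 1] x [-e, e]; the height
    of the centre does not affect the area. *)
Lemma area_bandD a g (e : R) : nonneg_width g -> compact (band 0 g) -> cvx (band 0 g) -> 0 <= e ->
  area (band a (g \+ cst e)) = (area (band 0 g) + (4 * e)%:E)%E.
Proof.
move=> wg cg vg e0; have E : band a (cst e) = box 1 1 (e - a) (a + e).
  by apply/seteqP; split => -[x y] [/= ? ? ? ?]; split => //=; lra.
rewrite -[X in band X _](add0r a) bandD//; last by move=> x _; rewrite addr_ge0.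
rewrite area_fiber_add//.
- rewrite E area_box; [congr (_ + _%:E)%E; ring|lra|lra].
- by rewrite E; exact: box_compact.
- by rewrite E; exact: box_cvx.
move=> x; split=> -[y [/= x1 x2 h1 h2]].
  by exists a; split => //=; rewrite ?gerBl ?lerDl.
have x12 : -1 <= x <= 1 by rewrite x1.
exists (g x); split => //=; rewrite ?add0r//.
by have := wg x x12; lra.
Qed.

Lemma lp_good_parallelogram (l11 l12 l21 l22 b d b' d' : R) :
  l11 * l22 - l12 * l21 != 0 -> 0 <= b -> 0 <= d -> 0 <= b' -> 0 <= d' ->
  (forall x, (exists y, (linmap l11 l12 l21 l22 @^-1` box b d b' d') (x, y)) <-> -1 <= x <= 1) ->
  lp_good (linmap l11 l12 l21 l22 @^-1` box b d b' d').
Proof.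
move=> D0 b0 d0 b'0 d'0 pr; split => //.
- by apply: preimage_linmap_compact => //; exact: box_compact.
- by apply: preimage_linmap_cvx; exact: box_cvx.
- by rewrite /linmap /box/= !mulr0 !addr0; split; rewrite ?oppr_le0.
- exact: (area_lp_diff_parallelogram p_gt1 pq).
Qed.

Variable th : R.
Hypotheses (th_ge : -1 <= th) (th_le : th <= 1).

(** A band of centre (0, a) contains the origin when |a| <= g 0.  The height
    a = th * g 0 is additive in [g], so that the bands of [g1] and [g2] add up
    to the band of their sum with the origin kept in each of them. *)
Definition lp_goodf (g : R -> R) := nonneg_width g /\ lp_good (band (th * g 0) g).

Lemma lp_goodfD g1 g2 : lp_goodf g1 -> lp_goodf g2 -> lp_goodf (g1 \+ g2).
Proof.
move=> [w1 G1] [w2 G2]; split.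
  by move=> x x1; rewrite /= addrACA addr_ge0 ?w1 ?w2.
have -> : th * (g1 \+ g2) 0 = th * g1 0 + th * g2 0 by exact: mulrDr.
by rewrite (bandD _ _ w1 w2); exact: lp_good_fiber_add.
Qed.

(** The band of a linear function is a segment, a degenerate parallelogram. *)
Lemma lp_goodf_lin (m : R) : lp_goodf (fun x => m * x).
Proof.
split; first by move=> x _; rewrite mulrN subrr.
have E : band (th * (m * 0)) (fun x => m * x) = linmap 1 0 (- m) 1 @^-1` box 1 1 0 0.
  by apply/seteqP; split => -[x y]; rewrite /linmap/box => -[/= ? ? ? ?]; split => //=; lra.
rewrite E; apply: lp_good_parallelogram; rewrite ?ler01//; first by apply/eqP; lra.
move=> x; rewrite -E; split=> [[y [/= ? ? _ _]]|/andP[? ?]]; first by apply/andP.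
by exists (m * x); split => //=; lra.
Qed.

Lemma lp_goodf_cst (b : R) : 0 <= b -> lp_goodf (cst b).
Proof.
move=> b0; split; first by move=> x _; rewrite addr_ge0.
have E : band (th * b) (cst b) = linmap 1 0 0 1 @^-1` box 1 1 (b - th * b) (th * b + b).
  by apply/seteqP; split => -[x y]; rewrite /linmap/box => -[/= ? ? ? ?]; split => //=; lra.
have tb1 : th * b <= b by rewrite ler_piMl.
have tb2 : - b <= th * b by rewrite -mulN1r ler_wpM2r.
have D0 : (1 * 1 - 0 * 0 != 0 :> R) by apply/eqP; lra.
rewrite /= E; apply: lp_good_parallelogram; rewrite ?ler01//; try lra.
move=> x; rewrite -E; split=> [[y [/= ? ? _ _]]|/andP[? ?]]; first by apply/andP.
by exists (th * b); split => //=; lra.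
Qed.

(** The concave function that vanishes at -1 and 1, and is affine on each side
    of [z], with slopes (1 - z)/2 and -(1 + z)/2. *)
Definition tent (z x : R) := Num.min ((1 - z) * (1 + x)) ((1 + z) * (1 - x)) / 2.

(** A convex kink is an affine function minus a tent, so a concave kink is an
    affine function plus a tent. *)
Lemma hinge_tent z x : Num.max (x - z) 0 = (1 - z) * (1 + x) / 2 - tent z x.
Proof.
rewrite /tent; have [xz|xz] := leP ((1 - z) * (1 + x)) ((1 + z) * (1 - x)).
  by rewrite subrr; apply/max_idPr; lra.
rewrite (max_idPl _); lra.
Qed.

Lemma tent_ge0 z x : -1 <= z <= 1 -> -1 <= x <= 1 -> 0 <= tent z x.
Proof.
move=> /andP[z1 z2] /andP[x1 x2]; rewrite /tent divr_ge0// le_min.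
by rewrite !mulr_ge0//; lra.
Qed.

(** The band of a tent is the parallelogram with vertices (-1, a), (1, a), the
    apex over [z], and its reflection in the centre (0, a). *)
Lemma lp_goodf_tent w z : 0 <= w -> -1 < z < 1 -> lp_goodf (fun x => w * tent z x).
Proof.
move=> w0 /andP[z1 z2].
have z12 : -1 <= z <= 1 by rewrite !ltW.
split.
  move=> x x1; rewrite addr_ge0// mulr_ge0// tent_ge0//.
  by rewrite lerN2 lerNl andbC.
move: w0; rewrite le_eqVlt => /predU1P[<-|w0].
  have := (lp_goodf_cst (lexx 0)).2.
  by congr lp_good; congr (band (th * _) _); [|apply/funext => x]; rewrite /= mul0r.
set a := th * _.
have t0 : 0 <= w * tent z 0 by rewrite mulr_ge0 ?tent_ge0 ?ltW//; apply/andP; split; lra.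
have ha1 : `|a| <= w * tent z 0 by rewrite /a normrM (ger0_norm t0) ler_piMl// ler_norml th_ge.
have ta : tent z 0 <= (1 - z) / 2 by rewrite /tent addr0 subr0 !mulr1 ler_pM2r// ge_min lexx.
have tb : tent z 0 <= (1 + z) / 2 by rewrite /tent addr0 subr0 !mulr1 ler_pM2r// ge_min lexx orbT.
have [ha2 ha3] : - (w * ((1 - z) / 2)) <= a /\ a <= w * ((1 - z) / 2).
  have h : w * tent z 0 <= w * ((1 - z) / 2) by rewrite ler_pM2l.
  by move: ha1; rewrite ler_norml => /andP[? ?]; split; lra.
have [hb2 hb3] : - (w * ((1 + z) / 2)) <= a /\ a <= w * ((1 + z) / 2).
  have h : w * tent z 0 <= w * ((1 + z) / 2) by rewrite ler_pM2l.
  by move: ha1; rewrite ler_norml => /andP[? ?]; split; lra.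
(* The two coordinates of the linear map are constant along the two pairs of
   parallel sides, which have slopes w (1 - z)/2 and - w (1 + z)/2.  The bound
   |a| <= w * tent z 0 says that the origin is between the sides. *)
have E : band a (fun x => w * tent z x) =
    linmap (- (w * ((1 - z) / 2))) 1 (w * ((1 + z) / 2)) 1 @^-1`
      box (w * ((1 - z) / 2) - a) (a + w * ((1 - z) / 2))
          (w * ((1 + z) / 2) - a) (a + w * ((1 + z) / 2)).
  have T x y : y <= a + w * tent z x <->
      y <= a + w * ((1 - z) * (1 + x) / 2) /\ y <= a + w * ((1 + z) * (1 - x) / 2).
    rewrite /tent; have [xz|xz] := leP ((1 - z) * (1 + x)) ((1 + z) * (1 - x)).
      split=> [h|[]//]; split => //; apply: (le_trans h); rewrite lerD2l ler_pM2l// ler_pM2r//.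
    split=> [h|[]//]; split => //; apply: (le_trans h); rewrite lerD2l ler_pM2l// ler_pM2r// ltW//.
  have T' x y : a - w * tent z x <= y <->
      a - w * ((1 - z) * (1 + x) / 2) <= y /\ a - w * ((1 + z) * (1 - x) / 2) <= y.
    split=> [h|[h1 h2]].
      have /T[h1 h2] : 2 * a - y <= a + w * tent z x by lra.
      by split; lra.
    have : 2 * a - y <= a + w * tent z x by apply/T; split; lra.
    lra.
  apply/seteqP; split => -[x y]; rewrite /linmap/box/=.
    move=> [/= x1 x2 /T'[h1 h2] /T[h3 h4]].
    split; lra.
  move=> [/= h1 h2 h3 h4].
  split => /=.
  - rewrite -(ler_pM2l w0); lra.
  - rewrite -(ler_pM2l w0); lra.
  - by apply/T'; split; lra.
  - by apply/T; split; lra.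
have D0 : - (w * ((1 - z) / 2)) * 1 - 1 * (w * ((1 + z) / 2)) != 0.
  by rewrite (_ : _ - _ = - w); [rewrite oppr_eq0 gt_eqF|lra].
rewrite E; apply: lp_good_parallelogram => //; try lra.
move=> x; rewrite -E; split=> [[y [/= ? ? _ _]]|/andP[x1 x2]]; first by apply/andP.
have x12 : -1 <= x <= 1 by rewrite x1.
have x12' : -1 <= - x <= 1 by rewrite lerN2 lerNl x2 x1.
exists a; split => //=; rewrite ?gerBl ?lerDl mulr_ge0 ?tent_ge0// ltW//.
Qed.

End bands.

(** * Piecewise linear interpolation *)

Section interpolation.
Variable R : realType.
Variables (f : R -> R) (n : nat).

Definition mesh : R := 2 / n.+1%:R.
Definition knot (k : nat) : R := -1 + k%:R * mesh.
Definition slope (k : nat) : R := (f (knot k.+1) - f (knot k)) / mesh.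
Definition bend (k : nat) : R := slope k.-1 - slope k.
(** The interpolant of [f] at the knots, written as its first affine piece
    corrected by one hinge at each interior knot. *)
Definition interp (x : R) : R := f (-1) + slope 0 * (x + 1) -
  \sum_(1 <= k < n.+1) bend k * Num.max (x - knot k) 0.

Lemma mesh_gt0 : 0 < mesh.
Proof. by rewrite divr_gt0. Qed.

Lemma knot0 : knot 0 = -1.
Proof. by rewrite /knot mul0r addr0. Qed.

Lemma knotS k : knot k.+1 = knot k + mesh.
Proof. by rewrite /knot -natr1; ring. Qed.

Lemma knot_last : knot n.+1 = 1.
Proof. by rewrite /knot /mesh mulrC divfK ?pnatr_eq0//; lra. Qed.

Lemma le_knot i j : (i <= j)%N -> knot i <= knot j.
Proof. by move=> ij; rewrite /knot lerD2l ler_pM2r ?mesh_gt0// ler_nat. Qed.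

Lemma lt_knot i j : (i < j)%N -> knot i < knot j.
Proof. by move=> ij; rewrite /knot ltrD2l ltr_pM2r ?mesh_gt0// ltr_nat. Qed.

Lemma knot_itv k : (k <= n.+1)%N -> -1 <= knot k <= 1.
Proof. by move=> kn; rewrite -{1}knot0 -knot_last !le_knot. Qed.

Lemma knot_cell x : -1 <= x <= 1 ->
  exists2 j, (j < n.+1)%N & knot j <= x <= knot j.+1.
Proof.
rewrite -{1}knot0 -knot_last => /andP[x0].
suff H m : x <= knot m.+1 -> exists2 j, (j < m.+1)%N & knot j <= x <= knot j.+1.
  exact: H.
elim: m => [xm|m IH xm]; first by exists 0%N => //; rewrite x0 xm.
have [h|h] := leP x (knot m.+1).
  by have [j jm jx] := IH h; exists j => //; rewrite ltnS ltnW.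
by exists m.+1 => //; rewrite xm ltW.
Qed.

Lemma slopeE k : f (knot k.+1) = f (knot k) + slope k * mesh.
Proof. by rewrite /slope divfK ?gt_eqF ?mesh_gt0//; ring. Qed.

Lemma sum_bend j x : \sum_(1 <= k < j.+1) bend k * (x - knot k) =
  f (-1) + slope 0 * (x + 1) - (f (knot j) + slope j * (x - knot j)).
Proof.
elim: j => [|j IH]; first by rewrite big_geq// knot0; ring.
by rewrite big_nat_recr//= IH /bend/= slopeE knotS; ring.
Qed.

Lemma interp_cell j x : (j < n.+1)%N -> knot j <= x <= knot j.+1 ->
  interp x = f (knot j) + slope j * (x - knot j).
Proof.
move=> jn /andP[xj xj1]; rewrite /interp (@big_cat_nat _ _ _ j.+1)//=.
rewrite [X in _ - (_ + X)]big1_seq ?addr0; last first.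
  move=> k; rewrite mem_index_iota => /andP[_ /andP[jk _]].
  rewrite (max_idPr _) ?mulr0// subr_le0 (le_trans xj1)// le_knot//.
rewrite [X in _ - X](_ : _ = \sum_(1 <= k < j.+1) bend k * (x - knot k)).
  by rewrite sum_bend; ring.
apply: eq_big_nat => k /andP[_ kj]; congr (_ * _); apply/max_idPl.
by rewrite subr_ge0 (le_trans _ xj)// le_knot.
Qed.

Lemma interp_comb x : -1 <= x <= 1 -> exists j t, [/\ (j < n.+1)%N, 0 <= t <= 1,
  x = t * knot j + (1 - t) * knot j.+1, knot j <= x <= knot j.+1 &
  interp x = t * f (knot j) + (1 - t) * f (knot j.+1)].
Proof.
move=> /knot_cell[j jn xj]; have m0 := mesh_gt0.
have mn0 : mesh != 0 by rewrite gt_eqF.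
exists j, ((knot j.+1 - x) / mesh); split => //.
- case/andP: xj; rewrite knotS => h1 h2.
  by rewrite divr_ge0 ?subr_ge0 ?(ltW m0)//= ler_pdivrMr// mul1r; lra.
- by rewrite knotS; field.
- by rewrite (interp_cell jn xj) /slope knotS; field.
Qed.

Hypothesis f_concave : forall x y t, -1 <= x <= 1 -> -1 <= y <= 1 -> 0 <= t <= 1 ->
  t * f x + (1 - t) * f y <= f (t * x + (1 - t) * y).

Lemma interp_le x : -1 <= x <= 1 -> interp x <= f x.
Proof.
move=> /interp_comb[j [t [jn t01 -> _ ->]]].
by apply: f_concave => //; apply: knot_itv => //; exact: ltnW.
Qed.

Lemma le_interp L x : (forall x y, -1 <= x <= 1 -> -1 <= y <= 1 -> f x - f y <= L * `|x - y|) ->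
  0 <= L -> -1 <= x <= 1 -> f x <= interp x + L * mesh.
Proof.
move=> fL L0 x1; have [j [t [jn /andP[t0 t1] _ /andP[xj xj1] ->]]] := interp_comb x1.
have kj := knot_itv (ltnW jn); have kj1 := knot_itv jn.
have h1 : f x - f (knot j) <= L * mesh.
  apply: (le_trans (fL _ _ x1 kj)); rewrite ler_wpM2l// ger0_norm ?subr_ge0//.
  by move: xj1; rewrite knotS; lra.
have h2 : f x - f (knot j.+1) <= L * mesh.
  apply: (le_trans (fL _ _ x1 kj1)); rewrite ler_wpM2l// distrC ger0_norm ?subr_ge0//.
  by move: xj; rewrite knotS; lra.
have : 0 <= t * (L * mesh - (f x - f (knot j))) by rewrite mulr_ge0// subr_ge0.
have : 0 <= (1 - t) * (L * mesh - (f x - f (knot j.+1))) by rewrite mulr_ge0 ?subr_ge0.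
lra.
Qed.

Lemma bend_ge0 k : (0 < k < n.+1)%N -> 0 <= bend k.
Proof.
move=> /andP[k0 kn]; rewrite /bend /slope prednK// -mulrBl divr_ge0 ?(ltW mesh_gt0)//.
have := f_concave (t := 2^-1) (knot_itv (leq_trans (leq_pred k) (ltnW kn))) (knot_itv kn).
have -> : 2^-1 * knot k.-1 + (1 - 2^-1) * knot k.+1 = knot k.
  have E : knot k = knot k.-1 + mesh by rewrite -knotS prednK.
  by rewrite knotS E; field.
have h2 : 0 <= (2^-1 : R) <= 1 by rewrite invr_ge0 ler0n invf_le1 ?ler1n.
move=> /(_ h2); lra.
Qed.

Variables (p q th : R).
Hypotheses (p_gt1 : 1 < p) (pq : p^-1 + q^-1 = 1).
Hypotheses (th_ge : -1 <= th) (th_le : th <= 1).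
Hypothesis f_end : 0 <= f 1 + f (-1).

Lemma lp_goodf_sum (r : seq nat) (w z : nat -> R) :
  (forall k, k \in r -> 0 <= w k /\ -1 < z k < 1) ->
  lp_goodf q th (fun x => \sum_(k <- r) w k * tent (z k) x).
Proof.
elim: r => [_|k r IH H].
  have := lp_goodf_cst p_gt1 pq th_ge th_le (lexx 0).
  by congr lp_goodf; apply/funext => x; rewrite big_nil.
have [wk zk] := H k (mem_head _ _).
have H' j : j \in r -> 0 <= w j /\ -1 < z j < 1.
  by move=> jr; apply: H; rewrite inE jr orbT.
have := lp_goodfD p_gt1 pq (lp_goodf_tent p_gt1 pq th_ge th_le wk zk) (IH H').
by congr lp_goodf; apply/funext => x; rewrite big_cons.
Qed.

(** By [hinge_tent] the interpolant is an affine function plus a combination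
    of tents, with coefficients [bend k] that are nonnegative by concavity.  As
    the tents vanish at the ends, the constant term of the affine part is
    (f 1 + f (-1)) / 2, which is nonnegative. *)
Lemma lp_goodf_interp : lp_goodf q th interp.
Proof.
pose S := \sum_(1 <= k < n.+1) bend k * (1 - knot k) / 2.
pose T x := \sum_(1 <= k < n.+1) bend k * tent (knot k) x.
have E x : interp x = (f (-1) + slope 0 - S) + (slope 0 - S) * x + T x.
  rewrite /interp (eq_bigr (fun k => bend k * (1 - knot k) / 2 * (1 + x) - bend k * tent (knot k) x)).
    by rewrite sumrB -mulr_suml -/S -/(T x); ring.
  by move=> k _; rewrite hinge_tent; field.
have T1 : T 1 = 0.
  rewrite /T big1_seq// => k; rewrite mem_index_iota => /andP[_ /andP[_ kn]].
  have /andP[_ k1] := knot_itv (ltnW kn).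
  by rewrite /tent subrr mulr0 (min_idPr _) ?mul0r ?mulr0// mulr_ge0// ?subr_ge0// addr_ge0.
have Tm1 : T (-1) = 0.
  rewrite /T big1_seq// => k; rewrite mem_index_iota => /andP[_ /andP[_ kn]].
  have /andP[k1 _] := knot_itv (ltnW kn).
  rewrite /tent subrr mulr0 (min_idPl _) ?mul0r ?mulr0// mulr_ge0//; lra.
have i1 : interp 1 = f 1.
  have n1 : knot n <= 1 <= knot n.+1 by rewrite -{1}knot_last le_knot//= knot_last lexx.
  rewrite (interp_cell (ltnSn n) n1).
  have -> : 1 - knot n = mesh by rewrite -knot_last knotS; ring.
  by rewrite -slopeE knot_last.
have i2 : interp (-1) = f (-1).
  have n1 : knot 0 <= -1 <= knot 1 by rewrite knot0 lexx -{1}knot0 le_knot.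
  rewrite (interp_cell (ltn0Sn n) n1) knot0; ring.
have c0 : 0 <= f (-1) + slope 0 - S.
  have e1 := E 1; have e2 := E (-1).
  rewrite i1 T1 addr0 mulr1 in e1; rewrite i2 Tm1 addr0 mulrN1 in e2.
  have -> : f (-1) + slope 0 - S = (f 1 + f (-1)) / 2 by rewrite e1 {2}e2; field.
  by rewrite divr_ge0.
have GT : lp_goodf q th T.
  apply: lp_goodf_sum => k; rewrite mem_index_iota => kn; split; first exact: bend_ge0.
  by case/andP: kn => k0 kn; rewrite -{1}knot0 -knot_last !lt_knot.
have := lp_goodfD p_gt1 pq (lp_goodfD p_gt1 pq
  (lp_goodf_cst p_gt1 pq th_ge th_le c0) (lp_goodf_lin p_gt1 pq th (slope 0 - S))) GT.
by congr lp_goodf; apply/funext => x; rewrite /= E.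
Qed.

End interpolation.

(** * Symmetric bodies in normal position *)

Lemma area_translate (R : realType) (a : plane R) (S : set (mplane R)) : measurable S ->
  area ((fun v : plane R => v - a) @^-1` S) = area S.
Proof.
move=> mS; pose f : mplane R -> mplane R := fun v => (1 * v.1 + - a.1, 1 * v.2 + - a.2).
have mf : measurable_fun setT f.
  apply/measurable_fun_pairP; split; apply: measurable_funD => //;
  exact: measurable_funM.
have -> : (fun v : plane R => v - a) = f.
  by apply/funext => -[x y]; rewrite /f !mul1r.
apply/esym; apply: (@product_measure_unique _ _ _ _ _ lebesgue_measure lebesgue_measure
  (pushforward (lebesgue_measure \x lebesgue_measure)%E f) _ S mS).
move=> A B mA mB.
change (area (f @^-1` (A `*` B)) = lebesgue_measure A * lebesgue_measure B)%E.
have h1 := @lebesgue_measure_affine R 1 (- a.1) A (oner_neq0 _) mA.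
have h2 := @lebesgue_measure_affine R 1 (- a.2) B (oner_neq0 _) mB.
rewrite normr1 invr1 mul1e in h1; rewrite normr1 invr1 mul1e in h2.
rewrite (_ : _ @^-1` _ = ((fun y => 1 * y + - a.1) @^-1` A) `*` ((fun y => 1 * y + - a.2) @^-1` B))//.
have mA' (b : R) (E : set (measurableTypeR R)) : measurable E ->
    measurable ((fun y : measurableTypeR R => 1 * y + b) @^-1` E).
  move=> mE; have : measurable_fun setT (fun y : measurableTypeR R => 1 * y + b).
    by apply: measurable_funD => //; exact: measurable_funM.
  by move=> /(_ measurableT _ mE); rewrite setTI.
by rewrite area_setX ?h1 ?h2//; exact: mA'.
Qed.

Lemma plane_eq (R : realType) (u v : plane R) :
  (u.1 : R) = v.1 -> (u.2 : R) = v.2 -> u = v.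
Proof. by case: u v => [? ?] [? ?] /= -> ->. Qed.

Lemma compact_translate (R : realType) (a : plane R) (K : set (plane R)) :
  compact K -> compact ((fun v : plane R => v - a) @^-1` K).
Proof.
move=> cK; have -> : (fun v : plane R => v - a) @^-1` K = (fun v : plane R => v + a) @` K.
  apply/seteqP; split => [v Kv|_ [v Kv <-]]; last by rewrite /= addrK.
  by exists (v - a) => //; rewrite subrK.
apply: continuous_compact => //; apply: continuous_subspaceT => v.
by apply: cvgD; [exact: cvg_id|exact: cvg_cst].
Qed.

(** The body is [K = C + (0, al)], where [C] is symmetric about the origin and
    has shadow [-1, 1].  The condition [C (0, al)] says that [K] contains the
    origin, since [C] is symmetric. *)
Section normal_position.
Variable R : realType.
Variables (p q : R).
Hypotheses (p_gt1 : 1 < p) (pq : p^-1 + q^-1 = 1).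
Variables (C : set (plane R)) (al : R).
Hypotheses (C_compact : compact C) (C_cvx : cvx C) (C_sym : forall v, C v -> C (- v)).
Hypotheses (C_strip : forall v, C v -> -1 <= v.1 <= 1) (C_edge : exists y, C (1, y)).
Hypothesis C_al : C (0, al).

Let C0 : C 0.
Proof.
have -> : 0 = 2^-1 *: (0, al) + (1 - 2^-1) *: - (0, al) :> plane R.
  by apply: plane_eq; rewrite /= /GRing.scale/=; field.
apply: C_cvx => //; first exact: C_sym.
by rewrite invr_ge0 ler0n invf_le1 ?ler1n.
Qed.

Let K : set (plane R) := (fun v : plane R => v - (0, al)) @^-1` C.

(** The upper boundary of [C] may be vertical over -1 and 1.  That of the
    dilate [D = (1 + e) C] is Lipschitz on [-1, 1], because it is concave and
    bounded on the larger interval [-(1 + e), 1 + e]. *)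
Section dilate.
Variable e : R.
Hypothesis e_gt0 : 0 < e.
Let r := 1 + e.

Let r_gt0 : 0 < r. Proof. by rewrite addr_gt0. Qed.

Let D : set (plane R) := linmap r^-1 0 0 r^-1 @^-1` C.

Let det_neq0 : r^-1 * r^-1 - 0 * 0 != 0.
Proof. by rewrite mul0r subr0 mulf_neq0// invr_eq0 gt_eqF. Qed.

Let D_compact : compact D. Proof. exact: preimage_linmap_compact. Qed.

Let D_cvx : cvx D. Proof. exact: preimage_linmap_cvx. Qed.

Let D_sym v : D v -> D (- v).
Proof. by rewrite /D /= linmapN; exact: C_sym. Qed.

Let area_D : area D = ((r ^+ 2)%:E * area C)%E.
Proof.
rewrite area_linmap//; last exact: compact_plane_measurable.
congr (_%:E * _)%E; rewrite mul0r subr0 gtr0_norm ?mulr_gt0 ?invr_gt0//.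
by rewrite -invfM invrK expr2.
Qed.

Let CD : C `<=` D.
Proof.
move=> [x y] Cv; rewrite /D/=.
have -> : linmap r^-1 0 0 r^-1 (x, y) = r^-1 *: (x, y) + (1 - r^-1) *: 0.
  by apply: plane_eq; rewrite /= /GRing.scale/=; ring.
apply: C_cvx => //; rewrite invr_ge0 (ltW r_gt0)/= invf_le1//.
by rewrite lerDl ltW.
Qed.

(** [C] contains a chord from (1, y0) to its opposite, and so its shadow is
    all of [-1, 1]. *)
Let D_proj x : - r <= x <= r -> exists y, D (x, y).
Proof.
move=> /andP[x1 x2]; have [y0 Cy] := C_edge; exists (x * y0).
rewrite /D/=; have rn0 : r != 0 by rewrite gt_eqF.
have -> : linmap r^-1 0 0 r^-1 (x, x * y0) =
  ((1 + x / r) / 2) *: (1, y0) + (1 - (1 + x / r) / 2) *: - (1, y0).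
  by apply: plane_eq; rewrite /= /GRing.scale/=; field.
apply: C_cvx => //; first exact: C_sym.
have : -1 <= x / r <= 1.
  by rewrite ler_pdivlMr// ler_pdivrMr// mulN1r mul1r x1.
by move=> /andP[? ?]; apply/andP; split; lra.
Qed.

Let D_top x : - r <= x <= r -> exists y, D (x, y) /\ forall y', D (x, y') -> y' <= y.
Proof.
move=> /D_proj[y Dxy].
have [S0|[a [b [ab E]]]] := xsection_cvx x D_compact D_cvx.
  by have h : xsection D x y by [exact: mem_set]; rewrite S0 in h.
exists b; split.
  have : xsection D x b by rewrite E /= in_itv/= ab lexx.
  by rewrite /xsection/= inE.
move=> y' Dy'; have : xsection D x y' by exact: mem_set.
by rewrite E /= in_itv/= => /andP[].
Qed.

(** With [g] the interpolant of the upper boundary [f] of [D], the band of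
    [g + e] contains [C] once the mesh is fine, and the band of [g] is
    contained in [D]; the difference of their areas is 4 e. *)
Lemma lp_diff_bound_dilate :
  (area (lp_diff q K) <=
   lq_cst q * ((r ^+ 2)%:E * area C + (4 * e)%:E))%E.
Proof.
have e0 := e_gt0.
have [f Hf] : exists f : R -> R, forall x, - r <= x <= r ->
    D (x, f x) /\ forall y', D (x, y') -> y' <= f x.
  have /choice[f Hf] : forall x : R, exists y : R, - r <= x <= r ->
      D (x, y) /\ forall y' : R, D (x, y') -> y' <= y.
    move=> x; have [h|h] := boolP (- r <= x <= r); last by exists 0.
    by have [y Hy] := D_top h; exists y.
  by exists f.
have fD x : - r <= x <= r -> D (x, f x) by move=> /Hf[].
have fmax x y : - r <= x <= r -> D (x, y) -> y <= f x by move=> /Hf[_ +] => /[apply].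
have itv1 (x : R) : -1 <= x <= 1 -> - r <= x <= r.
  by move=> /andP[? ?]; rewrite /r; apply/andP; split; lra.
have fconc (x y t : R) : - r <= x <= r -> - r <= y <= r -> 0 <= t <= 1 ->
    t * f x + (1 - t) * f y <= f (t * x + (1 - t) * y).
  move=> xr yr t01; have := D_cvx (fD _ xr) (fD _ yr) t01.
  apply: fmax; case/andP: xr => x1 x2; case/andP: yr => y1 y2; case/andP: t01 => t0 t1.
  change (- r <= t * x + (1 - t) * y <= r).
  have h1 : 0 <= t * (x + r) by rewrite mulr_ge0//; lra.
  have h2 : 0 <= (1 - t) * (y + r) by rewrite mulr_ge0//; lra.
  have h3 : 0 <= t * (r - x) by rewrite mulr_ge0//; lra.
  have h4 : 0 <= (1 - t) * (r - y) by rewrite mulr_ge0//; lra.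
  by apply/andP; split; lra.
have [B B0 fB] : exists2 B : R, 0 <= B & forall x : R, - r <= x <= r -> `|f x| <= B.
  have [M [_ HM]] := compact_bounded D_compact.
  exists (`|M| + 1); first by rewrite addr_ge0.
  move=> x /fD Dx; have : M < `|M| + 1 by rewrite (le_lt_trans (ler_norm M))// ltrDl.
  move=> /HM /(_ _ Dx); apply: le_trans.
  by rewrite /Num.norm/= le_max lexx orbT.
pose L := 2 * B / e.
have L0 : 0 <= L by rewrite divr_ge0 ?mulr_ge0// ltW.
(* The point between [x] and [x''] at distances in the ratio d : e.  It will be
   the second point of the Lipschitz estimate, with [x''] at distance [e]
   beyond it and so still in the larger interval. *)
have key (x x'' d : R) : - r <= x <= r -> - r <= x'' <= r -> 0 <= d ->
    f x - f ((e * x + d * x'') / (d + e)) <= L * d.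
  move=> xr xr'' d0; have de : 0 < d + e by rewrite ltr_wpDl.
  have den0 : d + e != 0 by rewrite gt_eqF.
  have t01 : 0 <= e / (d + e) <= 1.
    by rewrite divr_ge0 ?(ltW e0) ?(ltW de)//= ler_pdivrMr// mul1r lerDr.
  have := fconc _ _ _ xr xr'' t01.
  have -> : e / (d + e) * x + (1 - e / (d + e)) * x'' = (e * x + d * x'') / (d + e).
    by field.
  have -> : 1 - e / (d + e) = d / (d + e) by field.
  have -> : e / (d + e) = 1 - d / (d + e) by field.
  set s := d / (d + e) => h.
  have s0 : 0 <= s by rewrite divr_ge0// (ltW de).
  have fxx : f x - f x'' <= 2 * B.
    have := fB _ xr; have := fB _ xr''; rewrite !ler_norml => /andP[? ?] /andP[? ?]; lra.
  have h2 : s * (f x - f x'') <= s * (2 * B) by rewrite ler_wpM2l.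
  have h3 : s * (2 * B) <= L * d.
    rewrite /L /s mulrC -!mulrA ler_wpM2l// ler_wpM2l// mulrC ler_wpM2r//.
    by rewrite lef_pV2 ?posrE// lerDr.
  lra.
have fL (x y : R) : -1 <= x <= 1 -> -1 <= y <= 1 -> f x - f y <= L * `|x - y|.
  move=> x1 y1; have [xy|xy] := leP x y.
    have := key x (y + e) (y - x); rewrite subr_ge0 xy (distrC x) ger0_norm ?subr_ge0//.
    have yx : y - x + e != 0 by rewrite gt_eqF// ltr_wpDl ?subr_ge0.
    rewrite (_ : _ / _ = y); last by field.
    apply => //; first exact: itv1.
    by case/andP: y1 => ? ?; rewrite /r; apply/andP; split; lra.
  have := key x (y - e) (x - y); rewrite subr_ge0 (ltW xy) ger0_norm ?subr_ge0 ?(ltW xy)//.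
  have yx : x - y + e != 0 by rewrite gt_eqF// ltr_wpDl ?subr_ge0 ?(ltW xy).
  rewrite (_ : _ / _ = y); last by field.
  apply => //; first exact: itv1.
  by case/andP: y1 => ? ?; rewrite /r; apply/andP; split; lra.
pose n := Num.truncn (2 * L / e).
have mn : L * mesh R n <= e.
  have : 2 * L / e < n.+1%:R by exact: truncnS_gt.
  rewrite ltr_pdivrMr// /mesh => h.
  by rewrite mulrA ler_pdivrMr// (mulrC L) (mulrC e) ltW.
have fconc1 (x y t : R) : -1 <= x <= 1 -> -1 <= y <= 1 -> 0 <= t <= 1 ->
    t * f x + (1 - t) * f y <= f (t * x + (1 - t) * y).
  by move=> /itv1 ? /itv1 ? ?; exact: fconc.
pose g := interp f n.
have gf x : -1 <= x <= 1 -> g x <= f x by exact: interp_le.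
have fg x : -1 <= x <= 1 -> f x <= g x + e.
  by move=> x1; rewrite (le_trans (le_interp n fL L0 x1))// lerD2l.
have opp1 (x : R) : -1 <= x <= 1 -> -1 <= - x <= 1.
  by move=> /andP[? ?]; apply/andP; split; lra.
have CG v : C v -> v.2 <= g v.1 + e /\ - v.2 <= g (- v.1) + e.
  case: v => x y Cv; have x1 := C_strip Cv; split => /=.
    by rewrite (le_trans _ (fg _ x1))// fmax//; [exact: itv1|exact: CD].
  rewrite (le_trans _ (fg _ (opp1 _ x1)))// fmax//; first exact/itv1/opp1.
  exact/D_sym/CD.
pose G := g \+ cst e.
have [al1 al2] : al <= G 0 /\ - al <= G 0.
  by have := CG _ C_al; rewrite /= oppr0.
(* When [G 0 = 0] the quotient is 0, and [al = 0] as well. *)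
pose th := al / G 0.
have G0 : 0 <= G 0 by lra.
have thG : th * G 0 = al.
  have [Gz|Gz] := eqVneq (G 0) 0; last by rewrite /th divfK.
  by rewrite Gz mulr0; move: al1 al2; rewrite Gz; lra.
have [th1 th2] : -1 <= th /\ th <= 1.
  have [Gz|Gz] := eqVneq (G 0) 0; first by rewrite /th Gz invr0 mulr0 lerN10 ler01.
  have Gp : 0 < G 0 by rewrite lt_neqAle eq_sym Gz.
  by rewrite ler_pdivlMr// ler_pdivrMr// mulN1r mul1r; split; lra.
have f_end : 0 <= f 1 + f (-1).
  have h1 : -1 <= (1 : R) <= 1 by rewrite lexx andbT; lra.
  have := fmax _ _ (itv1 _ (opp1 _ h1)) (D_sym (fD _ (itv1 _ h1))).
  by rewrite /= -subr_ge0 opprK addrC.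
have N10 : -1 <= 0 :> R by lra.
(* The area of the band does not depend on the height of its centre; height 0
   is convenient to compare it with the symmetric set [D]. *)
have [wg [cg vg _ _ _]] := lp_goodf_interp n fconc1 p_gt1 pq N10 ler01 f_end.
rewrite mul0r in cg vg.
have [wG [cG vG _ _ gG]] := lp_goodfD p_gt1 pq (lp_goodf_interp n fconc1 p_gt1 pq th1 th2 f_end)
  (lp_goodf_cst p_gt1 pq th1 th2 (ltW e_gt0)).
rewrite -/g -/G thG in cG vG gG.
have cK : compact K by exact: compact_translate.
apply: (@le_trans _ _ (area (lp_diff q (band al G)))).
  apply: le_area.
  - by apply: compact_plane_measurable; exact: (lp_diff_compact p_gt1 pq).
  - by apply: compact_plane_measurable; exact: (lp_diff_compact p_gt1 pq).
  - apply: lp_diffS => -[x y] Cv.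
    have [/= + +] := CG _ Cv; have /= := C_strip Cv.
    rewrite subr0 => /andP[x1 x2] h1 h2; rewrite /band/G/=; split => //; lra.
apply: (le_trans gG).
rewrite lee_wpmul2l ?lq_cst_ge0// area_bandD// ?(ltW e_gt0)//.
rewrite leeD2r// -area_D; apply: le_area.
- exact: compact_plane_measurable.
- exact: compact_plane_measurable.
move=> [x y] [/= x1 x2 h1 h2].
have x12 : -1 <= x <= 1 by rewrite x1.
have D1 := fD _ (itv1 _ x12); have D2 := D_sym (fD _ (itv1 _ (opp1 _ x12))).
have D2' : D (x, - f (- x)).
  by rewrite (_ : (x, _) = - (- x, f (- x)))//; apply: plane_eq; rewrite /= ?opprK.
(* [D] contains the vertical segment from (x, - f (-x)) to (x, f x). *)
apply: (cvx_vertical D_cvx D2' D1).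
rewrite sub0r in h1; rewrite add0r in h2.
rewrite (le_trans h2 (gf _ x12)) andbT (le_trans _ h1)// lerN2.
exact/gf/opp1.
Qed.

End dilate.

Lemma lp_diff_bound_normal : (area (lp_diff q K) <= lq_cst q * area C)%E.
Proof.
have [B Cbox] : exists B, C `<=` box 1 1 B B.
  have [M [_ HM]] := compact_bounded C_compact.
  exists (`|M| + 1) => -[x y] Cxy; have : M < `|M| + 1 by rewrite (le_lt_trans (ler_norm M))// ltrDl.
  move=> /HM /(_ _ Cxy); rewrite /Num.norm/= ge_max => /andP[_]; rewrite ler_norml => /andP[? ?].
  by have /andP[? ?] := C_strip Cxy; split.
have B0 : - B <= B by have [/= _ _] := Cbox _ C0; lra.
have : (area C <= ((1 + 1) * (B + B))%:E)%E.
  have h11 : -1 <= 1 :> R by lra.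
  rewrite -(area_box h11 B0).
  by apply: le_area => //; apply: compact_plane_measurable => //; exact: box_compact.
have := area_ge0 C; move: lp_diff_bound_dilate; have := lq_cst_ge0 q.
rewrite (lq_cstE p_gt1 pq); set c := (_ + _)%R; case: (area C) => [s| |]// + H.
rewrite !lee_fin => c0 s0 _; apply/lee_addgt0Pr => d d0.
pose e := Num.min 1 (d / (c * (3 * s + 4) + 1)).
have cs : 0 < c * (3 * s + 4) + 1 by rewrite ltr_wpDl// mulr_ge0// addr_ge0// mulr_ge0.
have e0 : 0 < e by rewrite lt_min ltr01 divr_gt0.
have e1 : e <= 1 by rewrite ge_min lexx.
have e2 : e * (c * (3 * s + 4) + 1) <= d by rewrite -ler_pdivlMr// ge_min lexx orbT.
apply: (le_trans (H _ e0)); change ((c * ((1 + e) ^+ 2 * s + 4 * e))%:E <= (c * s + d)%:E)%E; rewrite lee_fin.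
have h1 : (1 + e) ^+ 2 <= 1 + 3 * e by rewrite expr2; nra.
have h2 : (1 + e) ^+ 2 * s <= (1 + 3 * e) * s by rewrite ler_wpM2r.
have h3 : c * ((1 + e) ^+ 2 * s + 4 * e) <= c * ((1 + 3 * e) * s + 4 * e) by rewrite ler_wpM2l// lerD2r.
apply: (le_trans h3); lra.
Qed.

End normal_position.

(** * The inequality and the equality case *)

Section main_bound.
Variable R : realType.
Variables (p q : R).
Hypotheses (p_gt1 : 1 < p) (pq : p^-1 + q^-1 = 1).
Implicit Types (K C : set (plane R)).

Lemma center_opp K a : [set k - a | k in K] = [set a - k | k in K] ->
  forall v, K (v + a) -> K (- v + a).
Proof.
move=> E v Kv; have : [set k - a | k in K] v by exists (v + a) => //; rewrite addrK.
by rewrite E => -[k Kk <-]; rewrite opprB subrK.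
Qed.

(** An interior point can be moved in any direction; this yields a point of
    the body off the line spanned by the centre, hence positive width. *)
Lemma interior_move K x (d : plane R) : K° x -> exists2 t : R, 0 < t & K (x + t *: d).
Proof.
move=> /nbhs_ballP[e /= e0 eK].
pose t := e / (`|d.1| + `|d.2| + 1).
have dp : 0 < `|d.1| + `|d.2| + 1 by rewrite ltr_wpDl// addr_ge0.
have t0 : 0 < t by rewrite divr_gt0.
have H (y : R) : `|y| < `|d.1| + `|d.2| + 1 -> `|t * y| < e.
  move=> yd; rewrite normrM gtr0_norm// /t mulrAC ltr_pdivrMr//.
  by rewrite ltr_pM2l.
exists t => //; apply: eK; split; rewrite /ball/= opprD addNKr normrN; apply: H.
  by rewrite -addrA ltrDl ltr_wpDl.
by rewrite addrAC ltrDr ltr_wpDl.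
Qed.

(** The first coordinate of the linear map [L] is the functional [om], which
    vanishes at the centre [a], divided by its maximum over the centred body
    [C]; so the image of [C] has shadow [-1, 1] and the centre lies on the
    vertical axis. *)
Lemma lp_diff_bound K : convex_body K -> has_center_of_symmetry K -> K 0 ->
  (area (lp_diff q K) <= lq_cst q * area K)%E.
Proof.
move=> [cK /convex_setP vK [x0 Kx0]] [a Ka sym_a] K0.
have sK := center_opp sym_a.
pose C : set (plane R) := (fun v => v - - a) @^-1` K.
have CE v : C v = K (v + a) by rewrite /C/= opprK.
have cC : compact C by exact: compact_translate.
have vC : cvx C.
  move=> u v t; rewrite !CE => Ku Kv t01.
  have -> : t *: u + (1 - t) *: v + a = t *: (u + a) + (1 - t) *: (v + a).
    by apply: plane_eq; rewrite /= /GRing.scale/=; ring.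
  exact: vK.
have sC v : C v -> C (- v) by rewrite !CE; exact: sK.
have CNa : C (- a) by rewrite CE addNr.
have Ca : C a by rewrite -(opprK a); exact: sC.
(* [E] spans the line of the centre; any direction will do when [a = 0]. *)
have [E [kap aE E0]] : exists E : plane R, exists2 k : R, a = k *: E & 0 < E.1 ^+ 2 + E.2 ^+ 2.
  have [->|a0] := eqVneq a 0.
    exists (0, 1), 0; first by rewrite scale0r.
    by rewrite /= expr0n expr1n add0r ltr01.
  exists a, 1; first by rewrite scale1r.
  rewrite lt_neqAle addr_ge0 ?sqr_ge0// andbT eq_sym paddr_eq0 ?sqr_ge0// !sqrf_eq0.
  apply: contraNN a0 => /andP[/eqP a1 /eqP a2].
  by apply/eqP/plane_eq.
pose om (v : plane R) : R := v.1 * E.2 - v.2 * E.1.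
have om_cont : continuous om.
  move=> v; apply: cvgB; apply: cvgM; try exact: cvg_cst; by [exact: cvg_fst|exact: cvg_snd].
have C_neq0 : C !=set0 by exists a.
have [m /set_mem Cm mmax] := compact_EVT_max C_neq0 cC (continuous_subspaceT om_cont).
set h := om m in mmax.
have om_le v : C v -> om v <= h by move=> Cv; apply: mmax; exact: mem_set.
have omN v : om (- v) = - om v by rewrite /om/=; ring.
have h0 : 0 < h.
  have [t t0 Kt] := interior_move (E.2, - E.1) Kx0.
  pose c1 := x0 + t *: ((E.2, - E.1) : plane R) - a.
  have Cc1 : C c1 by rewrite CE subrK.
  have Cc0 : C (x0 - a) by rewrite CE subrK; exact: interior_subset.
  have omc : om c1 = om (x0 - a) + t * (E.1 ^+ 2 + E.2 ^+ 2).
    by rewrite /om /c1/= /GRing.scale/=; ring.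
  have [om0|om0] := leP 0 (om (x0 - a)).
    by rewrite (lt_le_trans _ (om_le _ Cc1))// omc ltr_wpDl// mulr_gt0.
  by rewrite (lt_le_trans _ (om_le _ (sC _ Cc0)))// omN oppr_gt0.
have hn0 : h != 0 by rewrite gt_eqF.
set N := E.1 ^+ 2 + E.2 ^+ 2 in E0.
have D0 : E.2 / h * E.2 - (- E.1 / h) * E.1 != 0.
  have -> : E.2 / h * E.2 - (- E.1 / h) * E.1 = N / h by rewrite /N; field.
  by rewrite mulf_neq0 ?invr_eq0// gt_eqF.
have [L' [LK L'K [l11 [l12 [l21 [l22 [L'E det']]]]]]] := linmap_bij D0.
set L := linmap (E.2 / h) (- E.1 / h) E.1 E.2 in LK L'K.
have L1 v : (L v).1 = om v / h by rewrite /L /linmap /om/=; field.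
pose C' := L' @^-1` C.
have C'L v : C' (L v) = C v by rewrite /C'/= LK.
have LL' u : L (L' u) = u by exact: L'K.
pose al : R := kap * N.
have La : L a = (0, al).
  by rewrite aE /L /linmap /al /N; apply: plane_eq; rewrite /= /GRing.scale/=; field.
have cC' : compact C' by rewrite /C' L'E; exact: preimage_linmap_compact.
have vC' : cvx C' by rewrite /C' L'E; exact: preimage_linmap_cvx.
have sC' v : C' v -> C' (- v).
  by rewrite /C'/= L'E linmapN; exact: sC.
have strip v : C' v -> -1 <= v.1 <= 1.
  rewrite -(LL' v) C'L => Cv; rewrite L1 ler_pdivlMr// ler_pdivrMr// mulN1r mul1r om_le// andbT.
  by rewrite lerNl -omN om_le//; exact: sC.
have edge : exists y, C' (1, y).
  exists (L m).2; rewrite (_ : (1, _) = L m) ?C'L//.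
  by apply: plane_eq => //; rewrite L1 -/h divff.
have C'al : C' (0, al) by rewrite -La C'L.
have := lp_diff_bound_normal p_gt1 pq cC' vC' sC' strip edge C'al.
set K' := _ @^-1` C' => H.
have E1 v : L v - (0, al) = L (v - a) by rewrite -La /L linmapD linmapN.
have K'L v : K' (L v) = K v.
  by change (C' (L v - (0, al)) = K v); rewrite E1 C'L CE subrK.
have cK' : compact K' by exact: compact_translate.
have aK' : area K' = area C' by apply: area_translate; exact: compact_plane_measurable.
clearbody K'.
have KK' : K = L @^-1` K' by apply/seteqP; split => v; rewrite /preimage/= K'L.
rewrite KK' /L (area_lp_diff_linmap p_gt1 pq D0 cK').
rewrite (area_linmap D0 (compact_plane_measurable cK')).
rewrite muleCA aK'; apply: lee_wpmul2l; last exact: H.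
by rewrite lee_fin invr_ge0 normr_ge0.
Qed.

Lemma free_det_neq0 (u v : plane R) : free [:: u; v] -> u.1 * v.2 - u.2 * v.1 != 0.
Proof.
rewrite free_cons seq1_free span_seq1 => /andP[uv v0].
apply: contraNN uv => /eqP d0; apply/vlineP.
have [v1|v1] := eqVneq (v.1 : R) 0; last first.
  exists (u.1 / v.1); apply: plane_eq; rewrite /= /GRing.scale/=; first by rewrite divfK.
  by rewrite mulrAC; apply: (canRL (mulfK v1)); lra.
have v2 : (v.2 : R) != 0.
  by apply: contraNN v0 => /eqP v2; apply/eqP; exact: plane_eq.
exists (u.2 / v.2); apply: plane_eq; rewrite /= /GRing.scale/=; last by rewrite divfK.
rewrite mulrAC; apply: (canRL (mulfK v2)); lra.
Qed.

Lemma lp_diff_parallelogram K : parallelogram_with_vertex 0 K ->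
  area (lp_diff q K) = (lq_cst q * area K)%E.
Proof.
move=> [u [v [/free_det_neq0 d0 KE]]].
set d := u.1 * v.2 - u.2 * v.1 in d0.
have D0 : v.2 / d * (u.1 / d) - (- v.1 / d) * (- u.2 / d) != 0.
  have -> : v.2 / d * (u.1 / d) - (- v.1 / d) * (- u.2 / d) = d^-1.
    by rewrite /d; field.
  by rewrite invr_eq0.
(* Cramer's rule: the coordinates with respect to the edges. *)
have -> : K = linmap (v.2 / d) (- v.1 / d) (- u.2 / d) (u.1 / d) @^-1` box 0 1 0 1.
  rewrite KE; apply/seteqP; split => x.
    move=> [s [t [/andP[s0 s1] /andP[t0 t1] ->]]].
    rewrite /preimage/= (_ : linmap _ _ _ _ _ = (s, t)).
      by split; rewrite /= ?oppr0.
    by apply: plane_eq; rewrite /linmap/= /GRing.scale/= /d; field.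
  rewrite /preimage/=; set z := linmap _ _ _ _ x => -[+ z2 + z4]; rewrite oppr0 => z1 z3.
  exists z.1, z.2; split; [exact/andP|exact/andP|].
  by apply: plane_eq; rewrite /z /linmap/= /GRing.scale/= /d; field.
exact: (area_lp_diff_parallelogram0 p_gt1 pq).
Qed.

End main_bound.

Theorem corollary29 (R : realType) (K : set (plane R)) (p q : R)
    (K_body : convex_body K) (K_sym : has_center_of_symmetry K) (K_0 : K 0)
    (p_gt1 : 1 < p) (pq : p^-1 + q^-1 = 1) :
  let c : R :=
    2 * Gamma (1 + 1 / q) ^+ 2 / Gamma (1 + 2 / q) + 2 in
  (area (Lp_sum p K (opp_set K)) <= c%:E * area K)%E /\
  (parallelogram_with_vertex 0 K ->
     area (Lp_sum p K (opp_set K)) = (c%:E * area K)%E).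
Proof.
have [cK /convex_setP vK _] := K_body.
rewrite (Lp_sumE p_gt1 pq cK (opp_set_compact cK) vK (opp_set_cvx vK) K_0 (opp_set0 K_0)).
move=> c; rewrite -lp_diffE (_ : c%:E = lq_cst q); last by rewrite (lq_cstE p_gt1 pq).
split; first exact: (lp_diff_bound p_gt1 pq).
exact: (lp_diff_parallelogram p_gt1 pq).
Qed.
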